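(* Let $R$ be a finite Lie conformal algebra which is free as a $\mathbb{C}[\partial]$-module and $V$ a free and finitely generated $\mathbb{C}[\partial]$-module. Let $\{e_j\}_{j=1}^n$ and $\{v_i\}_{i=1}^m$ be $\mathbb{C}[\partial]$-bases of $R$ and $V$ respectively, and $\{v_i^*\}_{i=1}^m$ the dual basis of $V^{*c}$. Suppose $\rho:R\to\mathrm{gc}(V)$ is a representation of $R$ and $\rho^*:R\to\mathrm{gc}(V^{*c})$ is its dual representation. Let $T\in\mathrm{Chom}(V,R)$ be such that $T_0=T_\lambda|_{\lambda=0}:V\to R$ is an $\mathcal{O}$-operator associated with $\rho$, where $T_\lambda(v_i)=\sum_{j=1}^na_{ij}(\lambda,\partial)e_j$ for any $i\in\{1,\dots,m\}$. Then $$r=\sum_{i,j}\big(a_{ij}(-1\otimes\partial-\partial\otimes1,\ \partial\otimes1)\,e_j\otimes v_i^*+a_{ij}(-1\otimes\partial-\partial\otimes1,\ 1\otimes\partial)\,v_i^*\otimes e_j\big)$$ is a symmetric solution of the conformal $S$-equation in $T_0(V)\ltimes_{\rho^*,0}V^{*c}$, where the left-symmetric conformal algebra structure on $T_0(V)$ is given by $$T_0(u)_\lambda T_0(v)=T_0(\rho(T_0(u))_\lambda v),\qquad u,v\in V.$$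
   Context: A Lie conformal algebra is a $\mathbb{C}[\partial]$-module $R$ with a $\mathbb{C}$-bilinear map $R\times R\to R[\lambda]$, $(a,b)\mapsto[a_\lambda b]$, such that $[\partial a_\lambda b]=-\lambda[a_\lambda b]$, $[a_\lambda \partial b]=(\partial+\lambda)[a_\lambda b]$, $[a_\lambda b]=-[b_{-\lambda-\partial}a]$ and $[a_\lambda[b_\mu c]]=[[a_\lambda b]_{\lambda+\mu}c]+[b_\mu[a_\lambda c]]$. A left-symmetric conformal algebra is a $\mathbb{C}[\partial]$-module $A$ with a $\mathbb{C}$-bilinear map $A\times A\to A[\lambda]$, $(a,b)\mapsto a_\lambda b$, such that $(\partial a)_\lambda b=-\lambda a_\lambda b$, $a_\lambda(\partial b)=(\partial+\lambda)a_\lambda b$ and $(a_\lambda b)_{\lambda+\mu}c-a_\lambda(b_\mu c)=(b_\mu a)_{\lambda+\mu}c-b_\mu(a_\lambda c)$; put $[a_\lambda b]=a_\lambda b-b_{-\lambda-\partial}a$ in $A$. ''Finite'' means finitely generated over $\mathbb{C}[\partial]$. Convention: substituting $-\lambda-\partial$ for $\lambda$ in $\sum_n\lambda^nc_n$ gives $\sum_n(-\lambda-\partial)^nc_n$, with $\partial$ acting on the coefficients; linear maps are extended to polynomials coefficientwise. Tensor products are over $\mathbb{C}$. A representation $\rho:R\to\mathrm{gc}(V)$ is a $\mathbb{C}$-bilinear assignment $(a,v)\mapsto\rho(a)_\lambda v\in V[\lambda]$ with $\rho(\partial a)_\lambda v=-\lambda\rho(a)_\lambda v$, $\rho(a)_\lambda(\partial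 v)=(\partial+\lambda)\rho(a)_\lambda v$ and $\rho([a_\lambda b])_{\lambda+\mu}v=\rho(a)_\lambda(\rho(b)_\mu v)-\rho(b)_\mu(\rho(a)_\lambda v)$. $\mathrm{Chom}(V,R)$ is the set of $\mathbb{C}$-linear maps $T_\lambda:V\to R[\lambda]$ with $T_\lambda(\partial v)=(\partial+\lambda)T_\lambda(v)$. The conformal dual $V^{*c}$ is the set of $\mathbb{C}$-linear maps $f_\lambda:V\to\mathbb{C}[\lambda]$ with $f_\lambda(\partial v)=\lambda f_\lambda(v)$, with $(\partial f)_\lambda=-\lambda f_\lambda$; the dual basis satisfies $(v_i^* )_\lambda(v_k)=\delta_{ik}$. The dual representation is $(\rho^*(a)_\lambda f)_\mu v=-f_{\mu-\lambda}(\rho(a)_\lambda v)$. A $\mathbb{C}[\partial]$-module homomorphism $T:V\to R$ is an $\mathcal{O}$-operator associated with $\rho$ if $[T(u)_\lambda T(v)]=T(\rho(T(u))_\lambda v-\rho(T(v))_{-\lambda-\partial}u)$ for all $u,v\in V$. $T_0(V)\ltimes_{\rho^*,0}V^{*c}$ is the left-symmetric conformal algebra on the $\mathbb{C}[\partial]$-module $T_0(V)\oplus V^{*c}$ with product $(a+f)_\lambda(b+g)=a_\lambda b+\rho^*(a)_\lambda g$ for $a,b\in T_0(V)$, $f,g\in V^{*c}$. For $r=\sum_ir_i\otimes l_i$, $r^{21}=\sum_il_i\otimes r_i$, and $r$ is symmetric if $r=r^{21}$. The conformal $S$-equation for $r=\sum_ir_i\otimes l_i$ in a left-symmetric conformal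 algebra $A$ is $$\sum_{i,j}({l_j}_\mu r_i\otimes r_j\otimes l_i)|_{\mu=1\otimes\partial\otimes1}-\sum_{i,j}(r_j\otimes{l_j}_\mu r_i\otimes l_i)|_{\mu=\partial\otimes1\otimes1}-\sum_{i,j}(r_i\otimes r_j\otimes[{l_i}_\mu l_j])|_{\mu=\partial\otimes1\otimes1}=0\mod(\partial^{\otimes^3})$$ in $A\otimes A\otimes A$, where $\partial^{\otimes^3}=\partial\otimes1\otimes1+1\otimes\partial\otimes1+1\otimes1\otimes\partial$, ''mod $(\partial^{\otimes^3})$'' means modulo $\partial^{\otimes^3}(A\otimes A\otimes A)$, and the subscript means each power $\mu^n$ is replaced by the $n$-th power of the indicated operator.
   Formalization: The S-equation is asserted only when r lies in A⊗A for A = T_0(V)⊕V^{*c}; otherwise it has no meaning in A (e.g. zero bracket and ρ, T_λ(v)=λe, so T_0=0). Symmetry of r is proved in general, in (R⊕V^{*c})⊗(R⊕V^{*c}). *)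

(* Defs.v *)
From HB Require Import structures.
From mathcomp Require Import all_boot all_order all_algebra.
From mathcomp Require Import generic_quotient ring_quotient.
From mathcomp Require Import finmap.
From mathcomp Require Import boolp functions reals.
From mathcomp Require Export complex.
From mathcomp Require Export monalg.

Set Implicit Arguments.
Unset Strict Implicit.
Unset Printing Implicit Defensive.

Import GRing.Theory.

Local Open Scope ring_scope.
Local Open Scope quotient_scope.

(* A K[d]-module is an [lmodType {poly K}], d acting as 'X and the scalars K
   through constant polynomials; in the application K is the field of complex
   numbers. *)

Section Polynomials.

(* M[lambda] is {malg M[nat]}: [p@_n] is the coefficient of lambda^n and
   [<< x *g n >>] is lambda^n x.  Likewise M[lambda, mu] is
   {malg M[nat * nat]}, with [<< x *g (i, j) >>] = lambda^i mu^j x. *)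

Variables (R : pzRingType) (M N : lmodType R).

Definition mapc (I : choiceType) (f : M -> N) (p : {malg M[I]}) : {malg N[I]} :=
  \sum_(k <- msupp p) << f p@_k *g k >>.

Definition mshift (I : choiceType) (h : I -> I) (p : {malg M[I]}) :
  {malg M[I]} := \sum_(k <- msupp p) << p@_k *g h k >>.

(* Substitution of the operator [Phi] for the variable:
   sum_n lambda^n c_n is sent to sum_n Phi^n (emb c_n). *)
Definition psubst (W : zmodType) (Phi : W -> W) (emb : M -> W)
  (p : {malg M[nat]}) : W := \sum_(n <- msupp p) iter n Phi (emb p@_n).

End Polynomials.

Section ConformalModules.

Variable K : fieldType.
Implicit Types A B C M R V : lmodType {poly K}.

Definition del M (x : M) : M := 'X *: x.

Definition cstp M (x : M) : {malg M[nat]} := << x *g 0%N >>.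
Definition lam M (p : {malg M[nat]}) : {malg M[nat]} := mshift S p.
Definition delp M (p : {malg M[nat]}) : {malg M[nat]} := mapc (@del M) p.

Definition cstp2 M (x : M) : {malg M[(nat * nat)%type]} := << x *g (0%N, 0%N) >>.
Definition lam2 M (p : {malg M[(nat * nat)%type]}) : {malg M[(nat * nat)%type]} :=
  mshift (fun k => (k.1.+1, k.2)) p.
Definition mu2 M (p : {malg M[(nat * nat)%type]}) : {malg M[(nat * nat)%type]} :=
  mshift (fun k => (k.1, k.2.+1)) p.
Definition lammu2 M (p : {malg M[(nat * nat)%type]}) : {malg M[(nat * nat)%type]} :=
  lam2 p + mu2 p.

(* p(lambda) |-> p(-lambda-d) *)
Definition refl_subst M (p : {malg M[nat]}) : {malg M[nat]} :=
  psubst (fun q => - lam q - delp q) (@cstp M) p.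

Record conf_bilinear A B C (f : A -> B -> {malg C[nat]}) : Prop := {
  conf_addl : forall a a' b, f (a + a') b = f a b + f a' b;
  conf_addr : forall a b b', f a (b + b') = f a b + f a b';
  conf_scalel : forall (c : K) a b,
    f (c%:P *: a) b = mapc (fun x => c%:P *: x) (f a b);
  conf_scaler : forall (c : K) a b,
    f a (c%:P *: b) = mapc (fun x => c%:P *: x) (f a b);
  conf_dell : forall a b, f (del a) b = - lam (f a b);
  conf_delr : forall a b, f a (del b) = delp (f a b) + lam (f a b)
}.

Section Compositions.
Variables A B C D E : lmodType {poly K}.

(* a_lambda (b_mu c) *)
Definition comp_lam_mu (f : A -> D -> {malg E[nat]})
    (g : B -> C -> {malg D[nat]}) (a : A) (b : B) (c : C) :
    {malg E[(nat * nat)%type]} :=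
  psubst (@mu2 E) (fun y => psubst (@lam2 E) (@cstp2 E) (f a y)) (g b c).

(* b_mu (a_lambda c) *)
Definition comp_mu_lam (f : B -> D -> {malg E[nat]})
    (g : A -> C -> {malg D[nat]}) (b : B) (a : A) (c : C) :
    {malg E[(nat * nat)%type]} :=
  psubst (@lam2 E) (fun y => psubst (@mu2 E) (@cstp2 E) (f b y)) (g a c).

(* (a_lambda b)_(lambda+mu) c *)
Definition comp_lam_sum (f : D -> C -> {malg E[nat]})
    (g : A -> B -> {malg D[nat]}) (a : A) (b : B) (c : C) :
    {malg E[(nat * nat)%type]} :=
  psubst (@lam2 E) (fun y => psubst (@lammu2 E) (@cstp2 E) (f y c)) (g a b).

(* (b_mu a)_(lambda+mu) c *)
Definition comp_mu_sum (f : D -> C -> {malg E[nat]})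
    (g : B -> A -> {malg D[nat]}) (b : B) (a : A) (c : C) :
    {malg E[(nat * nat)%type]} :=
  psubst (@mu2 E) (fun y => psubst (@lammu2 E) (@cstp2 E) (f y c)) (g b a).

End Compositions.

Record is_lie_conformal R (br : R -> R -> {malg R[nat]}) : Prop := {
  lie_bilinear : conf_bilinear br;
  lie_skew : forall a b, br a b = - refl_subst (br b a);
  lie_jacobi : forall a b c,
    comp_lam_mu br br a b c = comp_lam_sum br br a b c + comp_mu_lam br br b a c
}.

Record is_left_symmetric_conformal A (pr : A -> A -> {malg A[nat]}) : Prop := {
  lsca_bilinear : conf_bilinear pr;
  lsca_left_symmetric : forall a b c,
    comp_lam_sum pr pr a b c - comp_lam_mu pr pr a b c =
    comp_mu_sum pr pr b a c - comp_mu_lam pr pr b a c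
}.

Definition commutator A (pr : A -> A -> {malg A[nat]}) (a b : A) :
  {malg A[nat]} := pr a b - refl_subst (pr b a).

Record is_representation R V (br : R -> R -> {malg R[nat]})
    (rho : R -> V -> {malg V[nat]}) : Prop := {
  rep_bilinear : conf_bilinear rho;
  rep_bracket : forall a b v,
    comp_lam_sum rho br a b v =
    comp_lam_mu rho rho a b v - comp_mu_lam rho rho b a v
}.

(* a(lambda, d) x, with lambda the outer and d the inner variable of a *)
Definition poly_act M (a : {poly {poly K}}) (x : M) : {malg M[nat]} :=
  \sum_(k < size a) << a`_k *: x *g (k : nat) >>.

Definition is_basis M (n : nat) (e : 'I_n -> M) : Prop :=
  forall x : M, exists! c : {ffun 'I_n -> {poly K}}, x = \sum_j c j *: e j.

End ConformalModules.

Section Chom.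

Variables (K : fieldType) (V R : lmodType {poly K}).

Record chom := Chom {
  chom_fun :> V -> {malg R[nat]};
  chomD : forall u v, chom_fun (u + v) = chom_fun u + chom_fun v;
  chomZ : forall (c : K) v,
    chom_fun (c%:P *: v) = mapc (fun x => c%:P *: x) (chom_fun v);
  chom_del : forall v, chom_fun (del v) = delp (chom_fun v) + lam (chom_fun v)
}.

(* T_lambda at lambda = 0 *)
Definition chom0 (T : chom) (v : V) : R := (T v)@_0%N.

End Chom.

Section Coefficients.

Variables (R : pzRingType) (M N : lmodType R).

Lemma mcoeff_mapc (I : choiceType) (f : M -> N) (p : {malg M[I]}) k :
  f 0 = 0 -> (mapc f p)@_k = f p@_k.
Proof.
move=> f0; rewrite /mapc raddf_sum /=.
under eq_bigr => i _ do rewrite mcoeffU.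
case: (msuppP p k) => [kp|kp]; last first.
  by rewrite f0 big1_fset // => i ip _; case: eqP ip kp => // -> ->.
rewrite (big_fsetD1 k) //= eqxx mulr1n big1_fset ?addr0 // => i.
by rewrite in_fsetD1 => /andP[/negPf ->].
Qed.

Lemma mcoeff_mshift0 (p : {malg M[nat]}) : (mshift S p)@_0%N = 0.
Proof.
by rewrite /mshift raddf_sum /= big1 // => i _; rewrite mcoeffU.
Qed.

End Coefficients.

Section ChomZero.

Variables (K : fieldType) (V R : lmodType {poly K}) (T : chom V R).

Fact chom0_linear : linear (chom0 T).
Proof.
have TD u v : chom0 T (u + v) = chom0 T u + chom0 T v.
  by rewrite /chom0 chomD mcoeffD.
have TZ (c : K) v : chom0 T (c%:P *: v) = c%:P *: chom0 T v.
  by rewrite /chom0 chomZ mcoeff_mapc // scaler0.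
have TX v : chom0 T ('X *: v) = 'X *: chom0 T v.
  rewrite /chom0 -/(del v) chom_del mcoeffD [X in _ + X]mcoeff_mshift0 addr0.
  by rewrite mcoeff_mapc // /del scaler0.
move=> p u v; rewrite TD; congr (_ + _).
elim/poly_ind: p u => [|p c IH] u.
  by rewrite !scale0r -(scale0r 0) -[0 in LHS](polyC0 K) TZ polyC0 !scale0r.
by rewrite !scalerDl TD TZ -!scalerA IH TX.
Qed.

HB.instance Definition _ :=
  GRing.isLinear.Build {poly K} V R _ (chom0 T) chom0_linear.

End ChomZero.

Section Image.

Variables (S : pzRingType) (V R : lmodType S) (f : {linear V -> R}).

Definition img_pred : {pred R} := fun x => `[< exists v, f v = x >].

Fact img_submod_closed : submod_closed img_pred.
Proof.
split; first by apply/asboolP; exists 0; rewrite linear0.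
move=> a _ _ /asboolP[u <-] /asboolP[v <-]; apply/asboolP.
by exists (a *: u + v); rewrite linearP.
Qed.

HB.instance Definition _ :=
  GRing.isSubmodClosed.Build S R img_pred img_submod_closed.

(* the submodule f(V) of R *)
Record img := Img { img_val :> R; img_valP : img_val \in img_pred }.

HB.instance Definition _ := [isSub for img_val].
HB.instance Definition _ := [Choice of img by <:].
HB.instance Definition _ := [SubChoice_isSubLmodule of img by <:].

Fact to_img_subproof v : f v \in img_pred.
Proof. by apply/asboolP; exists v. Qed.

Definition to_img (v : V) : img := Img (to_img_subproof v).

End Image.

Section ConformalDual.

Variables (K : fieldType) (V : lmodType {poly K}).

Definition is_cdual (f : V -> {poly K}) : Prop :=
  [/\ forall u v, f (u + v) = f u + f v,
      forall (c : K) v, f (c%:P *: v) = c *: f v &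
      forall v, f (del v) = 'X * f v].

Definition cdual_pred : {pred (V -> {poly K})} := fun f => `[< is_cdual f >].

Fact cdual_zmod_closed : zmod_closed cdual_pred.
Proof.
split.
  by apply/asboolP; split=> *; rewrite ?addr0 ?scaler0 ?mulr0.
move=> f g /asboolP[fD fZ fX] /asboolP[gD gZ gX]; apply/asboolP.
split=> [u v|c v|v]; rewrite !fctE.
- by rewrite fD gD opprD addrACA.
- by rewrite fZ gZ scalerBr.
- by rewrite fX gX mulrBr.
Qed.

HB.instance Definition _ :=
  GRing.isZmodClosed.Build (V -> {poly K}) cdual_pred cdual_zmod_closed.

Record cdual := CDual { cdual_fun :> V -> {poly K};
                        cdualP : cdual_fun \in cdual_pred }.

HB.instance Definition _ := [isSub for cdual_fun].
HB.instance Definition _ := [Choice of cdual by <:].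
HB.instance Definition _ := [SubChoice_isSubZmodule of cdual by <:].

(* (d f)_lambda = - lambda f_lambda, hence p(d) acts as p(- lambda). *)
Fact cdual_scale_subproof (p : {poly K}) (f : cdual) :
  (fun v => (p \Po (- 'X)) * f v) \in cdual_pred.
Proof.
have /asboolP[fD fZ fX] := cdualP f; apply/asboolP.
split=> [u v|c v|v].
- by rewrite fD mulrDr.
- by rewrite fZ scalerAr.
- by rewrite fX mulrCA.
Qed.

Definition cdual_scale (p : {poly K}) (f : cdual) : cdual :=
  CDual (cdual_scale_subproof p f).

Fact cdual_scaleA a b f :
  cdual_scale a (cdual_scale b f) = cdual_scale (a * b) f.
Proof. by apply/val_inj/funext=> v /=; rewrite comp_polyM mulrA. Qed.

Fact cdual_scale1 : left_id 1 cdual_scale.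
Proof. by move=> f; apply/val_inj/funext=> v /=; rewrite comp_polyC mul1r. Qed.

Fact cdual_scaleDr : right_distributive cdual_scale +%R.
Proof. by move=> a f g; apply/val_inj/funext=> v /=; rewrite mulrDr. Qed.

Fact cdual_scaleDl f : {morph cdual_scale^~ f : a b / a + b}.
Proof.
by move=> a b; apply/val_inj/funext=> v /=; rewrite comp_polyD mulrDl.
Qed.

HB.instance Definition _ := GRing.Zmodule_isLmodule.Build {poly K} cdual
  cdual_scaleA cdual_scale1 cdual_scaleDr cdual_scaleDl.

Variable (R : lmodType {poly K}).

(* (rho^*(a)_lambda f)_mu v = - f_(mu - lambda) (rho(a)_lambda v), an identity
   in K[lambda, mu] = {poly {poly K}}, the outer variable being lambda. *)
Definition is_dual_representation (rho : R -> V -> {malg V[nat]})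
    (rhos : R -> cdual -> {malg cdual[nat]}) : Prop :=
  forall a f v,
    psubst ( *%R 'X) (fun g : cdual => (g v)%:P) (rhos a f) =
    - psubst ( *%R 'X)
        (fun w : V => (map_poly (polyC \o polyC) (f w)).['X%:P - 'X])
        (rho a v) :> {poly {poly K}}.

End ConformalDual.

Section Tensor.

Variables (K : fieldType) (U V : lmodType K).

Local Notation free_mod := {malg K[(U * V)%type]}.

Inductive tensor_rel : free_mod -> Prop :=
| tensor_rel0 : tensor_rel 0
| tensor_relD x y : tensor_rel x -> tensor_rel y -> tensor_rel (x + y)
| tensor_relZ c x : tensor_rel x -> tensor_rel (c *: x)
| tensor_rel_addl u u' v :
    tensor_rel (<< (u + u', v) >> - << (u, v) >> - << (u', v) >>)
| tensor_rel_addr u v v' :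
    tensor_rel (<< (u, v + v') >> - << (u, v) >> - << (u, v') >>)
| tensor_rel_scalel c u v :
    tensor_rel (<< (c *: u, v) >> - c *: << (u, v) >>)
| tensor_rel_scaler c u v :
    tensor_rel (<< (u, c *: v) >> - c *: << (u, v) >>).

Definition tensor_ker : {pred free_mod} := fun x => `[< tensor_rel x >].

Fact tensor_ker_zmod_closed : zmod_closed tensor_ker.
Proof.
split; first by apply/asboolP; exact: tensor_rel0.
move=> x y /asboolP xP /asboolP yP; apply/asboolP/tensor_relD => //.
by rewrite -scaleN1r; apply: tensor_relZ.
Qed.

HB.instance Definition _ :=
  GRing.isZmodClosed.Build free_mod tensor_ker tensor_ker_zmod_closed.

Definition tensor : Type := Quotient.quot tensor_ker.

HB.instance Definition _ := GRing.Zmodule.on tensor.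

Definition tensor_pi (x : free_mod) : tensor := \pi_(Quotient.quot tensor_ker) x.
Definition tensor_repr (z : tensor) : free_mod := repr z.

Fact tensor_reprK : cancel tensor_repr tensor_pi.
Proof. exact: reprK. Qed.

Fact tensor_piP x y : tensor_rel (x - y) <-> tensor_pi x = tensor_pi y.
Proof.
split=> [/asboolP h|h].
  by apply/eqP; rewrite /tensor_pi -Quotient.idealrBE.
by apply/asboolP; move/eqP: h; rewrite /tensor_pi -Quotient.idealrBE.
Qed.

Fact tensor_piD x y : tensor_pi (x + y) = tensor_pi x + tensor_pi y.
Proof. exact: raddfD. Qed.

Definition tensor_scale (c : K) (z : tensor) : tensor :=
  tensor_pi (c *: tensor_repr z).

Fact tensor_scale_pi c x : tensor_scale c (tensor_pi x) = tensor_pi (c *: x).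
Proof.
apply/tensor_piP; rewrite -scalerBr; apply: tensor_relZ.
by apply/tensor_piP; rewrite tensor_reprK.
Qed.

Fact tensor_scaleA a b z :
  tensor_scale a (tensor_scale b z) = tensor_scale (a * b) z.
Proof. by rewrite -[z]tensor_reprK !tensor_scale_pi scalerA. Qed.

Fact tensor_scale1 : left_id 1 tensor_scale.
Proof. by move=> z; rewrite -[z]tensor_reprK !tensor_scale_pi scale1r. Qed.

Fact tensor_scaleDr : right_distributive tensor_scale +%R.
Proof.
move=> a x y; rewrite -[x]tensor_reprK -[y]tensor_reprK -tensor_piD.
by rewrite !tensor_scale_pi scalerDr tensor_piD.
Qed.

Fact tensor_scaleDl z : {morph tensor_scale^~ z : a b / a + b}.
Proof.
by move=> a b; rewrite -[z]tensor_reprK !tensor_scale_pi scalerDl tensor_piD.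
Qed.

HB.instance Definition _ := GRing.Zmodule_isLmodule.Build K tensor
  tensor_scaleA tensor_scale1 tensor_scaleDr tensor_scaleDl.

Definition tpure (u : U) (v : V) : tensor := tensor_pi << (u, v) >>.

Variable W : lmodType K.

Definition bilin (phi : U -> V -> W) : Prop :=
  [/\ forall u u' v, phi (u + u') v = phi u v + phi u' v,
      forall u v v', phi u (v + v') = phi u v + phi u v',
      forall c u v, phi (c *: u) v = c *: phi u v &
      forall c u v, phi u (c *: v) = c *: phi u v].

Definition free_lift (phi : U -> V -> W) (x : free_mod) : W :=
  \sum_(k <- msupp x) x@_k *: phi k.1 k.2.

(* The linear map sending u (x) v to phi u v, for phi bilinear
   (see [tlift_pure]). *)
Definition tlift (phi : U -> V -> W) (z : tensor) : W :=
  free_lift phi (tensor_repr z).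

End Tensor.

Notation "u ⊗ v" := (tpure u v) (at level 40, left associativity) : ring_scope.

Section TensorTheory.

Variables (K : fieldType) (U V : lmodType K).
Local Notation free_mod := {malg K[(U * V)%type]}.

Lemma tpureDl (u u' : U) (v : V) : (u + u') ⊗ v = u ⊗ v + u' ⊗ v.
Proof.
rewrite /tpure -tensor_piD; apply/tensor_piP.
by rewrite opprD addrA; exact: tensor_rel_addl.
Qed.

Lemma tpureDr (u : U) (v v' : V) : u ⊗ (v + v') = u ⊗ v + u ⊗ v'.
Proof.
rewrite /tpure -tensor_piD; apply/tensor_piP.
by rewrite opprD addrA; exact: tensor_rel_addr.
Qed.

Lemma tensor_piZ c (x : free_mod) : tensor_pi (c *: x) = c *: tensor_pi x.
Proof. by rewrite -tensor_scale_pi. Qed.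

Lemma tpureZl c (u : U) (v : V) : (c *: u) ⊗ v = c *: (u ⊗ v).
Proof.
by rewrite /tpure -tensor_piZ; apply/tensor_piP/tensor_rel_scalel.
Qed.

Lemma tpureZr c (u : U) (v : V) : u ⊗ (c *: v) = c *: (u ⊗ v).
Proof.
by rewrite /tpure -tensor_piZ; apply/tensor_piP/tensor_rel_scaler.
Qed.

Lemma tensor_span (z : tensor U V) :
  exists s : seq (U * V), z = \sum_(x <- s) x.1 ⊗ x.2.
Proof.
pose P (z : tensor U V) := exists s : seq (U * V), z = \sum_(x <- s) x.1 ⊗ x.2.
rewrite -/(P z) -[z]tensor_reprK [tensor_repr z]monalgE.
have P0 : P 0 by exists [::]; rewrite big_nil.
have PD x y : P x -> P y -> P (x + y).
  by case=> s -> [t ->]; exists (s ++ t); rewrite big_cat.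
rewrite -/(P _) /=.
elim: (X in \sum_(k <- X) _) => [|k s IH].
  rewrite big_nil; suff -> : tensor_pi (0 : free_mod) = 0 by [].
  by rewrite -(scale0r (0 : free_mod)) tensor_piZ scale0r.
rewrite big_cons tensor_piD; apply: PD => //.
exists [:: ((tensor_repr z)@_k *: k.1, k.2)]; rewrite big_seq1 /= tpureZl.
rewrite /tpure -tensor_piZ; congr tensor_pi; apply/malgP=> i.
by rewrite mcoeffZ !mcoeffU -surjective_pairing mulrnAr mulr1.
Qed.

Variable W : lmodType K.
Variables (phi : U -> V -> W) (phi_bilin : bilin phi).

Let free_liftw (d : {fset U * V}) (x : free_mod) : (msupp x `<=` d)%fset ->
  free_lift phi x = \sum_(k <- d) x@_k *: phi k.1 k.2.
Proof.
move=> sub; rewrite /free_lift; apply: big_fset_incl => // k _ kx.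
by rewrite mcoeff_outdom // scale0r.
Qed.

Let free_liftP c (x y : free_mod) :
  free_lift phi (c *: x + y) = c *: free_lift phi x + free_lift phi y.
Proof.
pose d := (msupp x `|` msupp y `|` msupp (c *: x + y))%fset.
rewrite !(@free_liftw d) ?fsubsetUr //.
- rewrite scaler_sumr -big_split /=; apply: eq_bigr => k _.
  by rewrite mcoeffD mcoeffZ scalerDl scalerA.
- by rewrite /d fsubsetU // fsubsetUr.
- by rewrite /d -fsetUA fsubsetUl.
Qed.

Let free_liftU k : free_lift phi << k >> = phi k.1 k.2.
Proof.
rewrite (@free_liftw [fset k]%fset) ?msuppU_le // big_seq_fset1.
by rewrite mcoeffUU scale1r.
Qed.

Let free_lift0 : free_lift phi 0 = 0.
Proof. by rewrite /free_lift msupp0 big_nil. Qed.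

Let free_liftZ c x : free_lift phi (c *: x) = c *: free_lift phi x.
Proof. by rewrite -[c *: x]addr0 free_liftP free_lift0 addr0. Qed.

Let free_liftD x y : free_lift phi (x + y) = free_lift phi x + free_lift phi y.
Proof. by rewrite -[x]scale1r free_liftP !scale1r. Qed.

Let free_liftB x y : free_lift phi (x - y) = free_lift phi x - free_lift phi y.
Proof. by rewrite -(scaleN1r y) free_liftD free_liftZ scaleN1r. Qed.

Let free_lift_rel (x : free_mod) : tensor_rel x -> free_lift phi x = 0.
Proof.
case: phi_bilin => Dl Dr Zl Zr.
elim=> {x} [|x y _ hx _ hy|c x _ hx|u u' v|u v v'|c u v|c u v].
- exact: free_lift0.
- by rewrite free_liftD hx hy addr0.
- by rewrite free_liftZ hx scaler0.
- by rewrite !free_liftB !free_liftU /= Dl addrAC addrK subrr.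
- by rewrite !free_liftB !free_liftU /= Dr addrAC addrK subrr.
- by rewrite free_liftB free_liftZ !free_liftU /= Zl subrr.
- by rewrite free_liftB free_liftZ !free_liftU /= Zr subrr.
Qed.

Let tlift_pi x : tlift phi (tensor_pi x) = free_lift phi x.
Proof.
apply/eqP; rewrite -subr_eq0 -free_liftB; apply/eqP/free_lift_rel.
by apply/tensor_piP; rewrite tensor_reprK.
Qed.

Lemma tlift_pure u v : tlift phi (u ⊗ v) = phi u v.
Proof. by rewrite tlift_pi free_liftU. Qed.

Lemma tlift_linear : linear (tlift phi).
Proof.
move=> c x y; rewrite -[x]tensor_reprK -[y]tensor_reprK.
by rewrite -tensor_piZ -tensor_piD !tlift_pi free_liftP.
Qed.

End TensorTheory.

Section TensorMaps.

Variable K : fieldType.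

Definition tmap (U V U' V' : lmodType K) (f : U -> U') (g : V -> V') :
  tensor U V -> tensor U' V' := tlift (fun u v => f u ⊗ g v).

Definition tswap (U V : lmodType K) : tensor U V -> tensor V U :=
  tlift (fun u v => v ⊗ u).

Lemma tmap_bilin (U V U' V' : lmodType K) (f : U -> U') (g : V -> V') :
  linear f -> linear g -> bilin (fun u v => f u ⊗ g v).
Proof.
move=> fL gL.
have [fD fZ] : (forall x y, f (x + y) = f x + f y) /\
               (forall c x, f (c *: x) = c *: f x).
  have f0 : f 0 = 0.
    by have := fL (-1) 0 0; rewrite scaleN1r oppr0 addr0 scaleN1r addNr.
  split=> [x y|c x]; first by have := fL 1 x y; rewrite !scale1r.
  by have := fL c x 0; rewrite f0 !addr0.
have [gD gZ] : (forall x y, g (x + y) = g x + g y) /\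
               (forall c x, g (c *: x) = c *: g x).
  have g0 : g 0 = 0.
    by have := gL (-1) 0 0; rewrite scaleN1r oppr0 addr0 scaleN1r addNr.
  split=> [x y|c x]; first by have := gL 1 x y; rewrite !scale1r.
  by have := gL c x 0; rewrite g0 !addr0.
by split=> *; rewrite ?fD ?gD ?fZ ?gZ ?tpureDl ?tpureDr ?tpureZl ?tpureZr.
Qed.

Lemma tmap_pure (U V U' V' : lmodType K) (f : U -> U') (g : V -> V') :
  linear f -> linear g -> forall u v, tmap f g (u ⊗ v) = f u ⊗ g v.
Proof. by move=> fL gL u v; exact: tlift_pure (tmap_bilin fL gL) u v. Qed.

Lemma tswap_pure (U V : lmodType K) (u : U) (v : V) : tswap (u ⊗ v) = v ⊗ u.
Proof.
rewrite /tswap tlift_pure //.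
by split=> *; rewrite ?tpureDl ?tpureDr ?tpureZl ?tpureZr.
Qed.

End TensorMaps.

(* Restriction of scalars from K[d] to K. *)
Definition restr (K : fieldType) (M : lmodType {poly K}) : Type := M.

Section Restriction.

Variables (K : fieldType) (M : lmodType {poly K}).

HB.instance Definition _ := GRing.Zmodule.on (restr M).

Definition restr_scale (c : K) (x : restr M) : restr M := c%:P *: (x : M).

Fact restr_scaleA a b x : restr_scale a (restr_scale b x) = restr_scale (a * b) x.
Proof. by rewrite /restr_scale scalerA polyCM. Qed.

Fact restr_scale1 : left_id 1 restr_scale.
Proof. by move=> x; rewrite /restr_scale scale1r. Qed.

Fact restr_scaleDr : right_distributive restr_scale +%R.
Proof. by move=> a x y; exact: scalerDr. Qed.

Fact restr_scaleDl x : {morph restr_scale^~ x : a b / a + b}.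
Proof. by move=> a b; rewrite /restr_scale polyCD scalerDl. Qed.

HB.instance Definition _ := GRing.Zmodule_isLmodule.Build K (restr M)
  restr_scaleA restr_scale1 restr_scaleDr restr_scaleDl.

End Restriction.

Section SEquation.

Variables (K : fieldType) (A : lmodType {poly K}).

Definition tensor2 : lmodType K := tensor (restr A) (restr A).
Definition tensor3 : lmodType K := tensor tensor2 (restr A).

Definition delr : restr A -> restr A := @del K A.
Definition idr : restr A -> restr A := id.

Fact delr_linear : linear delr.
Proof.
move=> c x y; rewrite /delr /del; apply: etrans (scalerDr 'X _ _) _.
by congr (_ + _); apply: etrans (scalerA _ _ _) _; rewrite mulrC -scalerA.
Qed.

Definition del2_1 : tensor2 -> tensor2 := tmap delr idr.
Definition del2_2 : tensor2 -> tensor2 := tmap idr delr.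

Definition del3_1 : tensor3 -> tensor3 := tmap del2_1 idr.
Definition del3_2 : tensor3 -> tensor3 := tmap del2_2 idr.
Definition del3_3 : tensor3 -> tensor3 := tmap (@id tensor2) delr.

Definition pure2 (a b : A) : tensor2 := (a : restr A) ⊗ (b : restr A).
Definition pure3 (a b c : A) : tensor3 := pure2 a b ⊗ (c : restr A).

Lemma del2_1_pure a b : del2_1 (pure2 a b) = pure2 (del a) b.
Proof. by apply: tmap_pure; [exact: delr_linear | move=> c x y]. Qed.

Lemma del2_2_pure a b : del2_2 (pure2 a b) = pure2 a (del b).
Proof. by apply: tmap_pure; [move=> c x y | exact: delr_linear]. Qed.

Lemma del3_1_pure a b c : del3_1 (pure3 a b c) = pure3 (del a) b c.
Proof.
rewrite /pure3 -del2_1_pure.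
by apply: tmap_pure; [exact: tlift_linear (tmap_bilin delr_linear _) | move=> k x y].
Qed.

Lemma del3_2_pure a b c : del3_2 (pure3 a b c) = pure3 a (del b) c.
Proof.
rewrite /pure3 -del2_2_pure.
by apply: tmap_pure; [exact: tlift_linear (tmap_bilin _ delr_linear) | move=> k x y].
Qed.

Lemma del3_3_pure a b c : del3_3 (pure3 a b c) = pure3 a b (del c).
Proof. by apply: tmap_pure; [move=> k x y | exact: delr_linear]. Qed.

(* a(Phi, Psi) applied to t, for commuting operators Phi and Psi and
   a(lambda, d) with outer variable lambda and inner variable d. *)
Definition act2 (W : lmodType K) (Phi Psi : W -> W) (a : {poly {poly K}})
    (t : W) : W :=
  \sum_(k < size a) \sum_(l < size a`_k)
    a`_k`_l *: iter k Phi (iter l Psi t).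

Variable pr : A -> A -> {malg A[nat]}.

(* Left-hand side of the S-equation for r = sum_(x <- s) x.1 (x) x.2. *)
Definition S_expr (s : seq (A * A)) : tensor3 :=
    \sum_(i <- s) \sum_(j <- s)
      psubst del3_2 (fun x => pure3 x j.1 i.2) (pr j.2 i.1)
  - \sum_(i <- s) \sum_(j <- s)
      psubst del3_1 (fun x => pure3 j.1 x i.2) (pr j.2 i.1)
  - \sum_(i <- s) \sum_(j <- s)
      psubst del3_1 (fun x => pure3 i.1 j.1 x) (commutator pr i.2 j.2).

Definition solves_S_equation (r : tensor2) : Prop :=
  forall s : seq (A * A), r = \sum_(x <- s) pure2 x.1 x.2 ->
    exists t : tensor3, S_expr s = del3_1 t + del3_2 t + del3_3 t.

Definition symmetric_tensor (r : tensor2) : Prop := tswap r = r.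

End SEquation.

Section Operators.

Variables (K : fieldType) (R V : lmodType {poly K}).
Variables (br : R -> R -> {malg R[nat]}) (rho : R -> V -> {malg V[nat]}).

Definition is_O_operator (T : {linear V -> R}) : Prop :=
  forall u v, br (T u) (T v) =
    mapc T (rho (T u) v - refl_subst (rho (T v) u)).

(* (a + f)_lambda (b + g) = a_lambda b + rho^*(a)_lambda g *)
Definition semidirect_product (T : {linear V -> R})
    (pT : img T -> img T -> {malg (img T)[nat]})
    (rhos : R -> cdual V -> {malg (cdual V)[nat]})
    (x y : img T * cdual V) : {malg (img T * cdual V)%type[nat]} :=
  mapc (fun b : img T => (b, 0)) (pT x.1 y.1) +
  mapc (fun g : cdual V => (0, g)) (rhos x.1 y.2).

Definition semidirect_incl (T : {linear V -> R}) (x : img T * cdual V) :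
  R * cdual V := (img_val x.1, x.2).

(* The injection of A (x) A into B (x) B, for A = T(V) + V^{*c} and
   B = R + V^{*c}. *)
Definition tensor2_incl (T : {linear V -> R}) :
    tensor2 (img T * cdual V)%type -> tensor2 (R * cdual V)%type :=
  tmap (U := restr (img T * cdual V)%type) (V := restr (img T * cdual V)%type)
    (U' := restr (R * cdual V)%type) (V' := restr (R * cdual V)%type)
    (@semidirect_incl T) (@semidirect_incl T).

Lemma tensor2_incl_pure (T : {linear V -> R}) (x y : img T * cdual V) :
  tensor2_incl (pure2 x y) = pure2 (semidirect_incl x) (semidirect_incl y).
Proof. by apply: tmap_pure => c u w. Qed.

(* The tensor r attached to T, in B (x) B for B = R + V^{*c}: the e_j need not
   lie in T_0(V), so r is an element of A (x) A, A = T_0(V) + V^{*c}, only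
   through [tensor2_incl]. *)
Definition r_tensor (n m : nat) (e : 'I_n -> R) (vs : 'I_m -> cdual V)
    (a : 'I_m -> 'I_n -> {poly {poly K}}) : tensor2 (R * cdual V)%type :=
  let Phi := fun t : tensor2 (R * cdual V)%type => - del2_2 t - del2_1 t in
  \sum_(i < m) \sum_(j < n)
    (act2 Phi (@del2_1 _ _) (a i j) (pure2 (e j, 0) (0, vs i)) +
     act2 Phi (@del2_2 _ _) (a i j) (pure2 (0, vs i) (e j, 0))).

End Operators.

(* Main.v *)
From HB Require Import structures.
Require Import Defs.
From mathcomp Require Import all_boot all_order all_algebra.
From mathcomp Require Import finmap boolp reals.

(** Write T_lambda = sum_k lambda^k T_k, A = T_0(V) + V^*, and d1, d2, d3 for the
    derivations of the tensor factors; congruences are modulo the image of the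
    total derivation.

    Left symmetry. Dualizing a representation gives a representation: the
    defining identity of the dual holds for any commuting operators in place of
    its two variables ([dual_rep_op]), and the bracket identity for the dual,
    evaluated on V, is that of [rho] with the two composites exchanged. For any
    representation of R, the product T_0(u) T_0(w) = T_0(rho(T_0 u) w), once skew
    symmetrized, acts as the bracket, because T_0 is an O-operator; this is the
    left-symmetry identity ([left_symmetric_action]), for rho in the component
    T_0(V) and for its dual in the component V^*.

    The S-equation. Its left-hand side is bilinear in r and, by conformal
    sesquilinearity, congruent to zero when one copy of r is a total derivative
    ([S_expr_modulo]). In r the variable lambda is replaced by - d1 - d2, so that
    the terms T_k with k > 0 contribute total derivatives and r may be replaced by
    r_0 = sum_i (T_0(v_i) (x) v_i^* + v_i^* (x) T_0(v_i)). The terms of the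
    S-equation for r_0 contain either rho(T_0(v_j)) v_i or its dual counterpart
    rho^*(T_0(v_j)) v_i^*, and they cancel in pairs because the canonical element
    sum_i v_i (x) v_i^* is invariant modulo total derivatives
    ([invariant_pairing], [canonical_solution]).

    Replacing r by r_0 inside A (x) A requires T_k(v_i) to lie in T_0(V) for every
    k. If r comes from A (x) A this is automatic: pairing the second factor with
    v_i, the variable of the functional being replaced by lambda + d, turns
    - d1 - d2 into lambda and hence r into T_lambda(v_i), while it sends A (x) A
    into T_0(V)[lambda] ([rform_descent]). The tensor of A (x) A is then
    determined by r, because the tensor product of linear injections over a field
    is injective ([tmap_inj]). *)

Set Implicit Arguments.
Unset Strict Implicit.
Unset Printing Implicit Defensive.

Import GRing.Theory.
Local Open Scope ring_scope.

(** * Additive maps and generalized polynomials *)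

Definition add_map (U V : zmodType) (f : U -> V) : Prop :=
  {morph f : x y / x + y}.

Section AdditiveMaps.

Variables U V W : zmodType.
Implicit Types (f g : U -> V) (h : V -> W).

Lemma add_map0 f : add_map f -> f 0 = 0.
Proof. by move=> fD; apply: (addrI (f 0)); rewrite -fD !addr0. Qed.

Lemma add_mapN f : add_map f -> {morph f : x / - x}.
Proof.
by move=> fD x; apply: (addrI (f x)); rewrite -fD !subrr; exact: add_map0.
Qed.

Lemma add_mapB f : add_map f -> {morph f : x y / x - y}.
Proof. by move=> fD x y; rewrite fD add_mapN. Qed.

Lemma add_map_sum f : add_map f -> forall (I : Type) (s : seq I) (P : pred I) F,
  f (\sum_(i <- s | P i) F i) = \sum_(i <- s | P i) f (F i).
Proof. by move=> fD I s P F; apply: (big_morph f fD); exact: add_map0. Qed.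

Lemma add_map_opp f : add_map f -> add_map (fun x => - f x).
Proof. by move=> fD x y; rewrite fD opprD. Qed.

Lemma add_map_add f g : add_map f -> add_map g -> add_map (fun x => f x + g x).
Proof. by move=> fD gD x y; rewrite fD gD addrACA. Qed.

Lemma add_map_sub f g : add_map f -> add_map g -> add_map (fun x => f x - g x).
Proof. by move=> fD gD; exact: add_map_add fD (add_map_opp gD). Qed.

Lemma add_map_comp f h : add_map f -> add_map h -> add_map (h \o f).
Proof. by move=> fD hD x y /=; rewrite fD hD. Qed.

End AdditiveMaps.

Lemma morph_oppB (U W : zmodType) (s : U -> W) f g f' g' t : add_map s ->
  (forall t, s (f t) = f' (s t)) -> (forall t, s (g t) = g' (s t)) ->
  s (- f t - g t) = - f' (s t) - g' (s t).
Proof. by move=> sD sf sg; rewrite (add_mapB sD) (add_mapN sD) sf sg. Qed.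

Lemma linear_add_map (S : pzRingType) (U V : lmodType S) (f : U -> V) :
  linear f -> add_map f.
Proof. by move=> fL x y; have := fL 1 x y; rewrite !scale1r. Qed.

Lemma linear_scale (S : pzRingType) (U V : lmodType S) (f : U -> V) :
  linear f -> forall c x, f (c *: x) = c *: f x.
Proof.
move=> fL c x; have := fL c x 0.
by rewrite (add_map0 (linear_add_map fL)) !addr0.
Qed.

Lemma add_map_iter (U : zmodType) (f : U -> U) n :
  add_map f -> add_map (iter n f).
Proof. by move=> fD x y; elim: n => //= n ->. Qed.

Lemma iter_swap (U V : Type) (F : U -> V) f g n :
  (forall x, F (f x) = g (F x)) -> forall x, F (iter n f x) = iter n g (F x).
Proof. by move=> Ff x; elim: n => //= n <-. Qed.

(** Commuting operators that agree after [pi] have iterates that agree after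
    [pi], even though [pi] need not be compatible with either of them. *)
Lemma iter_agree (W Q : Type) (pi : W -> Q) (F G : W -> W) n :
  (forall x, pi (F x) = pi (G x)) -> (forall x, G (F x) = F (G x)) ->
  forall x, pi (iter n F x) = pi (iter n G x).
Proof.
move=> FG GF; elim: n => //= n IH x.
by rewrite FG (iter_swap n GF) IH -iterSr.
Qed.

(** The operations [mapc], [mshift] and [psubst] are all instances of [msum], so
    that additivity and the value on monomials need to be proved only once. *)
Definition msum (I : choiceType) (M W : zmodType) (h : I -> M -> W)
  (p : {malg M[I]}) : W := \sum_(k <- msupp p) h k p@_k.

Section MonomialSums.

Variables (I : choiceType) (M W : zmodType) (h : I -> M -> W).
Hypothesis hD : forall k, add_map (h k).

Lemma msumEw (d : {fset I}) (p : {malg M[I]}) : (msupp p `<=` d)%fset ->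
  msum h p = \sum_(k <- d) h k p@_k.
Proof.
move=> sub; apply: big_fset_incl => // k _ kp.
by rewrite mcoeff_outdom // add_map0.
Qed.

Lemma msumD : add_map (msum h).
Proof.
move=> p q; pose d := (msupp p `|` msupp q)%fset.
rewrite !(@msumEw d) ?msuppD_le ?fsubsetUl ?fsubsetUr // -big_split /=.
by apply: eq_bigr => k _; rewrite mcoeffD hD.
Qed.

Lemma msumU k x : msum h << x *g k >> = h k x.
Proof.
by rewrite (msumEw msuppU_le) big_seq_fset1 mcoeffUU.
Qed.

End MonomialSums.

Lemma eq_add_malg (I : choiceType) (M W : zmodType) (F G : {malg M[I]} -> W) :
  add_map F -> add_map G -> (forall x k, F << x *g k >> = G << x *g k >>) ->
  F =1 G.
Proof.
move=> FD GD FG p; rewrite [p]monalgE (add_map_sum FD) (add_map_sum GD).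
by apply: eq_bigr => k _; exact: FG.
Qed.

Section CoefficientMaps.

Variable S : pzRingType.
Implicit Types M N P : lmodType S.

Lemma mapcD (I : choiceType) M N (f : M -> N) :
  add_map f -> add_map (@mapc S M N I f).
Proof.
move=> fD; apply: (@msumD I M _ (fun k x => << f x *g k >>)) => k x y.
by rewrite fD monalgUD.
Qed.

Lemma mapcU (I : choiceType) M N (f : M -> N) : add_map f ->
  forall k x, @mapc S M N I f << x *g k >> = << f x *g k >>.
Proof.
move=> fD; apply: (@msumU I M _ (fun k x => << f x *g k >>)) => k x y.
by rewrite fD monalgUD.
Qed.

Lemma mcoeffc (I : choiceType) M N (f : M -> N) (p : {malg M[I]}) k :
  add_map f -> (mapc f p)@_k = f p@_k.
Proof. by move=> fD; rewrite mcoeff_mapc // add_map0. Qed.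

Lemma mapc_comp (I : choiceType) M N P (f : M -> N) (g : N -> P)
  (p : {malg M[I]}) : add_map f -> add_map g ->
  mapc g (mapc f p) = mapc (g \o f) p.
Proof.
move=> fD gD; apply/malgP => k.
by rewrite !mcoeffc //; exact: add_map_comp.
Qed.

Lemma eq_mapc (I : choiceType) M N (f g : M -> N) (p : {malg M[I]}) :
  f =1 g -> mapc f p = mapc g p.
Proof. by move=> fg; apply: eq_bigr => k _; rewrite fg. Qed.

Lemma mshiftD (I : choiceType) M (s : I -> I) : add_map (@mshift S M I s).
Proof.
by apply: (@msumD I M _ (fun k x => << x *g s k >>)) => k x y; rewrite monalgUD.
Qed.

Lemma mshiftU (I : choiceType) M (s : I -> I) k x :
  @mshift S M I s << x *g k >> = << x *g s k >>.
Proof.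
apply: (@msumU I M _ (fun k x => << x *g s k >>)) => ? x' y.
by rewrite monalgUD.
Qed.

Lemma mapc_mshift (I : choiceType) M N (f : M -> N) (s : I -> I) :
  add_map f -> forall p, mapc f (mshift s p) = mshift s (mapc f p).
Proof.
move=> fD; apply: eq_add_malg => [||x k].
- exact: add_map_comp (mshiftD s) (mapcD fD).
- exact: add_map_comp (mapcD fD) (mshiftD s).
- by rewrite !(mshiftU, mapcU).
Qed.

Lemma mshiftC (I : choiceType) M (s t : I -> I) :
  (forall k, s (t k) = t (s k)) ->
  forall p : {malg M[I]}, mshift s (mshift t p) = mshift t (mshift s p).
Proof.
move=> st; apply: eq_add_malg => [||x k].
- exact: add_map_comp (mshiftD t) (mshiftD s).
- exact: add_map_comp (mshiftD s) (mshiftD t).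
- by rewrite !mshiftU st.
Qed.

End CoefficientMaps.

Section Substitution.

Variable S : pzRingType.
Implicit Types (M N : lmodType S) (W : zmodType).

Lemma psubstD M W (Phi : W -> W) (emb : M -> W) : add_map Phi -> add_map emb ->
  add_map (psubst Phi emb).
Proof.
move=> PhiD embD; apply: (@msumD nat M W (fun n x => iter n Phi (emb x))).
by move=> n x y; rewrite embD add_map_iter.
Qed.

Lemma psubstU M W (Phi : W -> W) (emb : M -> W) : add_map Phi -> add_map emb ->
  forall n x, psubst Phi emb << x *g n >> = iter n Phi (emb x).
Proof.
move=> PhiD embD; apply: (@msumU nat M W (fun n x => iter n Phi (emb x))).
by move=> n x y; rewrite embD add_map_iter.
Qed.

Lemma eq_psubst M W (Phi Psi : W -> W) (emb emb' : M -> W) p :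
  Phi =1 Psi -> emb =1 emb' -> psubst Phi emb p = psubst Psi emb' p.
Proof.
by move=> PP ee; apply: eq_bigr => n _; rewrite ee; exact: eq_iter.
Qed.

Lemma eq_psubstr M W (Phi : W -> W) (emb emb' : M -> W) p :
  emb =1 emb' -> psubst Phi emb p = psubst Phi emb' p.
Proof. exact: eq_psubst. Qed.

(** The way substitutions are moved through linear maps in all that follows: a
    map that intertwines [Phi] and [Psi] turns one substitution into the other. *)
Lemma psubst_nat M W W' (Phi : W -> W) (Psi : W' -> W') (g : W -> W')
    (emb : M -> W) p :
  add_map g -> (forall w, g (Phi w) = Psi (g w)) ->
  g (psubst Phi emb p) = psubst Psi (g \o emb) p.
Proof.
move=> gD gP; rewrite /psubst (add_map_sum gD); apply: eq_bigr => n _ /=.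
exact: iter_swap.
Qed.

Lemma psubst_addl M W (Phi : W -> W) (e1 e2 : M -> W) p : add_map Phi ->
  psubst Phi (fun x => e1 x + e2 x) p = psubst Phi e1 p + psubst Phi e2 p.
Proof.
move=> PhiD; rewrite /psubst -big_split /=; apply: eq_bigr => n _.
exact: add_map_iter.
Qed.

Lemma psubst_oppl M W (Phi : W -> W) (e1 : M -> W) p : add_map Phi ->
  psubst Phi (fun x => - e1 x) p = - psubst Phi e1 p.
Proof.
move=> PhiD; rewrite /psubst -sumrN; apply: eq_bigr => n _.
exact/add_mapN/add_map_iter.
Qed.

Lemma psubst_suml M W (Phi : W -> W) (I : finType) (e : I -> M -> W) p :
  add_map Phi ->
  psubst Phi (fun x => \sum_i e i x) p = \sum_i psubst Phi (e i) p.
Proof.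
move=> PhiD; rewrite /psubst exchange_big; apply: eq_bigr => n _ /=.
exact/add_map_sum/add_map_iter.
Qed.

Lemma psubst_mapc M N W (f : M -> N) (Phi : W -> W) (emb : N -> W) :
  add_map f -> add_map Phi -> add_map emb ->
  forall p, psubst Phi emb (mapc f p) = psubst Phi (emb \o f) p.
Proof.
move=> fD PD eD; apply: eq_add_malg => [||x k].
- exact: add_map_comp (mapcD fD) (psubstD PD eD).
- exact: psubstD PD (add_map_comp fD eD).
- by rewrite mapcU // !psubstU //; exact: add_map_comp.
Qed.

Lemma psubst_exchange M N W (Phi Psi : W -> W) (b : M -> N -> W) p q :
  add_map Phi -> add_map Psi -> (forall w, Phi (Psi w) = Psi (Phi w)) ->
  psubst Phi (fun x => psubst Psi (b x) q) p =
  psubst Psi (fun y => psubst Phi (b^~ y) p) q.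
Proof.
move=> PD QD PQ; rewrite /psubst.
under eq_bigr => n _ do rewrite (add_map_sum (add_map_iter n PD)).
under [RHS]eq_bigr => n _ do rewrite (add_map_sum (add_map_iter n QD)).
rewrite exchange_big; apply: eq_bigr => k _; apply: eq_bigr => n _.
by apply: iter_swap => w; apply/esym/iter_swap => {}w.
Qed.

(** Only the constant term escapes the image of [Phi]. *)
Lemma psubst_const M W (Phi : W -> W) (emb : M -> W) p : add_map Phi ->
  add_map emb -> exists w, psubst Phi emb p = emb p@_0%N + Phi w.
Proof.
move=> PD eD; have sD := psubstD PD eD.
rewrite (monalgE p); elim/big_ind: _ => [|q q' [w qE] [w' qE']|k _].
- by exists 0; rewrite mcoeff0 (add_map0 sD) (add_map0 eD) (add_map0 PD) addr0.
- by exists (w + w'); rewrite sD mcoeffD eD PD qE qE' addrACA.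
rewrite psubstU // mcoeffU; case: k => [|k] /=.
  by exists 0; rewrite mulr1n (add_map0 PD) addr0.
by exists (iter k Phi (emb p@_k.+1)); rewrite mulr0n (add_map0 eD) add0r.
Qed.

End Substitution.

Section ConformalPolynomials.

Variable K : fieldType.
Implicit Types M N : lmodType {poly K}.

Lemma delD M : add_map (@del K M).
Proof. by move=> x y; rewrite /del scalerDr. Qed.

Lemma scaleCD M (c : K) : add_map (fun x : M => c%:P *: x).
Proof. by move=> x y; rewrite scalerDr. Qed.

Lemma cstpD M : add_map (@cstp K M).
Proof. by move=> x y; rewrite /cstp monalgUD. Qed.

Lemma lamD M : add_map (@lam K M). Proof. exact: mshiftD. Qed.
Lemma delpD M : add_map (@delp K M). Proof. exact/mapcD/delD. Qed.

Lemma cstp2D M : add_map (@cstp2 K M).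
Proof. by move=> x y; rewrite /cstp2 monalgUD. Qed.

Lemma lam2D M : add_map (@lam2 K M). Proof. exact: mshiftD. Qed.
Lemma mu2D M : add_map (@mu2 K M). Proof. exact: mshiftD. Qed.
Lemma lammu2D M : add_map (@lammu2 K M).
Proof. exact: add_map_add (@lam2D M) (@mu2D M). Qed.

Lemma lam2_mu2 M (p : {malg M[(nat * nat)%type]}) : lam2 (mu2 p) = mu2 (lam2 p).
Proof. exact: mshiftC. Qed.

Lemma lam2_lammu2 M (p : {malg M[(nat * nat)%type]}) :
  lam2 (lammu2 p) = lammu2 (lam2 p).
Proof. by rewrite /lammu2 lam2D lam2_mu2. Qed.

Lemma mapc_lam M N (f : M -> N) p :
  add_map f -> mapc f (lam p) = lam (mapc f p).
Proof. by move=> fD; exact: mapc_mshift. Qed.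

Lemma mapc_delp M N (f : M -> N) p : add_map f ->
  (forall x, f (del x) = del (f x)) -> mapc f (delp p) = delp (mapc f p).
Proof.
move=> fD fdel; have [dM dN] := (@delD M, @delD N).
by rewrite /delp !mapc_comp //; exact: eq_mapc.
Qed.

Lemma mapc_scale M N (f : M -> N) (c : K) (p : {malg M[nat]}) : add_map f ->
  (forall x, f (c%:P *: x) = c%:P *: f x) ->
  mapc f (mapc (fun x => c%:P *: x) p) = mapc (fun x => c%:P *: x) (mapc f p).
Proof.
move=> fD fZ; have [cM cN] := (@scaleCD M c, @scaleCD N c).
by rewrite !mapc_comp //; exact: eq_mapc.
Qed.

Section Substitute.

Variables (M : lmodType {poly K}) (W : zmodType) (Phi : W -> W) (emb : M -> W).
Hypotheses (PhiD : add_map Phi) (embD : add_map emb).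

Lemma psubst_cstp x : psubst Phi emb (cstp x) = emb x.
Proof. by rewrite psubstU. Qed.

Lemma psubst_lam p : psubst Phi emb (lam p) = Phi (psubst Phi emb p).
Proof.
move: p; apply: eq_add_malg => [||x k].
- exact: add_map_comp (@lamD M) (psubstD PhiD embD).
- exact: add_map_comp (psubstD PhiD embD) PhiD.
- by rewrite /lam mshiftU !psubstU.
Qed.

Lemma psubst_lamN p : psubst Phi emb (- lam p) = - Phi (psubst Phi emb p).
Proof. by rewrite (add_mapN (psubstD PhiD embD)) psubst_lam. Qed.

Variable Delta : W -> W.
Hypotheses (DeltaD : add_map Delta)
  (emb_del : forall x, emb (del x) = Delta (emb x))
  (DeltaC : forall w, Delta (Phi w) = Phi (Delta w)).

Lemma psubst_delp p : psubst Phi emb (delp p) = Delta (psubst Phi emb p).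
Proof.
rewrite psubst_mapc //; last exact: delD.
rewrite (@psubst_nat _ _ _ _ Phi Phi) //; apply: eq_psubstr.
exact: emb_del.
Qed.

(** Substituting [Phi] in p(-lambda-d) amounts to substituting [- Phi - Delta] in
    p, because d acts on the coefficients through [Delta]. *)
Lemma psubst_refl p :
  psubst Phi emb (refl_subst p) = psubst (fun w => - Phi w - Delta w) emb p.
Proof.
have sD := psubstD PhiD embD.
rewrite (@psubst_nat _ _ _ _ _ (fun w => - Phi w - Delta w)) //.
  by apply: eq_psubstr => x; exact: psubst_cstp.
by move=> q; rewrite !(add_mapB sD, add_mapN sD) psubst_lam psubst_delp.
Qed.

End Substitute.

End ConformalPolynomials.

(** * Substituting operators in polynomials *)

Definition psum (S : nzRingType) (W : zmodType) (Phi : W -> W) (emb : S -> W)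
  (q : {poly S}) : W := \sum_(k < size q) iter k Phi (emb q`_k).

Section PolynomialSubstitution.

Variables (S : nzRingType) (W : zmodType) (Phi : W -> W) (emb : S -> W).
Hypotheses (PhiD : add_map Phi) (embD : add_map emb).

Lemma psumEw n (q : {poly S}) : (size q <= n)%N ->
  psum Phi emb q = \sum_(k < n) iter k Phi (emb q`_k).
Proof.
move=> qn; rewrite /psum (big_ord_widen n (fun k => iter k Phi (emb q`_k))) //.
rewrite big_mkcond; apply: eq_bigr => k _; case: ltnP => // qk.
by rewrite nth_default // (add_map0 embD) (add_map0 (add_map_iter k PhiD)).
Qed.

Lemma psumD : add_map (psum Phi emb).
Proof.
move=> p q; pose n := maxn (size p) (size q).
rewrite !(@psumEw n) ?leq_maxl ?leq_maxr ?size_polyD // -big_split /=.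
by apply: eq_bigr => k _; rewrite coefD embD add_map_iter.
Qed.

Lemma psumC c : psum Phi emb c%:P = emb c.
Proof. by rewrite (@psumEw 1) ?size_polyC ?leq_b1 // big_ord1 coefC. Qed.

Lemma psumMX q : psum Phi emb (q * 'X) = Phi (psum Phi emb q).
Proof.
rewrite (@psumEw (size q).+1); last first.
  by rewrite (leq_trans (size_polyMleq _ _)) // size_polyX addn2.
rewrite big_ord_recl coefMX /= (add_map0 embD) add0r /psum (add_map_sum PhiD).
by apply: eq_bigr => k _; rewrite coefMX.
Qed.

Lemma psumXM q : psum Phi emb ('X * q) = Phi (psum Phi emb q).
Proof. by rewrite -commr_polyX psumMX. Qed.

Lemma psumCM Psi x q : add_map Psi -> (forall w, Psi (Phi w) = Phi (Psi w)) ->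
  (forall c, emb (x * c) = Psi (emb c)) ->
  psum Phi emb (x%:P * q) = Psi (psum Phi emb q).
Proof.
move=> PsiD PC xc; rewrite (@psumEw (size q)); last first.
  by rewrite mul_polyC size_scale_leq.
rewrite /psum (add_map_sum PsiD); apply: eq_bigr => k _.
by rewrite coefCM xc; apply/esym/iter_swap.
Qed.

(** Every identity between a K[d]-module action and a substitution of operators
    is obtained by recognizing the former as [psum] through this lemma. *)
Lemma psum_unique (F : {poly S} -> W) : add_map F ->
  (forall c, F c%:P = emb c) -> (forall q, F (q * 'X) = Phi (F q)) ->
  F =1 psum Phi emb.
Proof.
move=> FD FC FX; elim/poly_ind => [|q c IH].
  by rewrite (add_map0 FD) (add_map0 psumD).
by rewrite FD FC FX IH psumD psumC psumMX.
Qed.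

End PolynomialSubstitution.

Lemma psum_nat (S : nzRingType) (W W' : zmodType) (Phi : W -> W)
    (Psi : W' -> W') (g : W -> W') (emb : S -> W) q :
  add_map g -> (forall w, g (Phi w) = Psi (g w)) ->
  g (psum Phi emb q) = psum Psi (g \o emb) q.
Proof.
move=> gD gP; rewrite /psum (add_map_sum gD); apply: eq_bigr => k _ /=.
exact: iter_swap.
Qed.

Lemma eq_psum (S : nzRingType) (W : zmodType) (Phi Psi : W -> W)
    (emb emb' : S -> W) q :
  Phi =1 Psi -> emb =1 emb' -> psum Phi emb q = psum Psi emb' q.
Proof. by move=> PP ee; apply: eq_bigr => k _; rewrite ee; exact: eq_iter. Qed.

(** * The dual representation *)

Section DualModule.

Variables (K : fieldType) (V : lmodType {poly K}).
Implicit Types (f g : cdual V) (v w : V).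

Lemma cdual_appD f v w : f (v + w) = f v + f w.
Proof. by have /asboolP[] := cdualP f. Qed.

Lemma cdual_app_addmap f : add_map f.
Proof. exact: cdual_appD. Qed.

Lemma cdual_appZ f p v : f (p *: v) = p * f v.
Proof.
have /asboolP[fD fZ fX] := cdualP f.
elim/poly_ind: p v => [|p c IH] v.
  by rewrite scale0r mul0r (add_map0 (cdual_app_addmap f)).
by rewrite scalerDl fD fZ -scalerA IH fX mulrA mulrDl mul_polyC.
Qed.

Lemma cdual_addE f g v : (f + g) v = f v + g v.
Proof. by []. Qed.

Lemma cdual_scaleE p f v : (p *: f) v = (p \Po - 'X) * f v.
Proof. by []. Qed.

Lemma cdual_ext f g : (forall v, f v = g v) -> f = g.
Proof. by move=> fg; apply/val_inj/funext. Qed.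

Lemma cdual_evalD v : add_map (fun f : cdual V => f v).
Proof. by []. Qed.

Variables (m : nat) (v : 'I_m -> V) (vs : 'I_m -> cdual V).
Hypotheses (vB : is_basis v) (vsv : forall i k, vs i (v k) = (i == k)%:R).

Lemma dual_basis_coord w : w = \sum_k vs k w *: v k.
Proof.
have [c [/= -> _]] := vB w; apply: eq_bigr => k _; congr (_ *: _).
rewrite (add_map_sum (cdual_app_addmap (vs k))) (bigD1 k) //= cdual_appZ vsv.
rewrite eqxx mulr1 big1 ?addr0 // => i ik.
by rewrite cdual_appZ vsv eq_sym (negPf ik) mulr0.
Qed.

(** The derivation acts on functionals by minus the variable, whence ['X] is
   replaced by [- 'X] in the coordinates. *)
Lemma dual_basis_expansion f : f = \sum_k ((f (v k)) \Po - 'X) *: vs k.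
Proof.
apply: cdual_ext => w; rewrite {1}[w]dual_basis_coord.
rewrite (add_map_sum (cdual_app_addmap f)) (add_map_sum (cdual_evalD w)).
apply: eq_bigr => k _; rewrite cdual_appZ cdual_scaleE mulrC.
by rewrite -comp_polyA raddfN /= comp_polyX opprK comp_polyXr.
Qed.

End DualModule.

Section DualRepresentation.

Variables (K : fieldType) (R V : lmodType {poly K}).
Variables (rho : R -> V -> {malg V[nat]}).
Variables (rhos : R -> cdual V -> {malg (cdual V)[nat]}).
Hypothesis rhosE : is_dual_representation rho rhos.

(** The defining identity of the dual representation is an equality of polynomials
    in lambda and mu, in which any commuting operators [L] and [N] may be
    substituted for the two variables. *)
Lemma dual_rep_op (W : zmodType) (L N : W -> W) (emb : K -> W) a f v :
  add_map L -> add_map N -> add_map emb -> (forall w, L (N w) = N (L w)) ->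
  psubst L (fun g : cdual V => psum N emb (g v)) (rhos a f) =
  - psubst L (fun w : V => psum (fun x => N x - L x) emb (f w)) (rho a v).
Proof.
move=> LD ND embD LN; have NE := psumD ND embD.
pose F : {poly {poly K}} -> W := psum L (psum N emb).
have FD : add_map F := psumD LD NE.
have FX q : F ('X * q) = L (F q) by exact: psumXM.
have FXC q : F ('X%:P * q) = N (F q).
  by apply: psumCM => // c; exact: psumXM.
(* mu - lambda is evaluated to the operator N - L. *)
have FS p : F (map_poly (polyC \o polyC) p).['X%:P - 'X] =
            psum (fun x => N x - L x) emb p.
  move: p; apply: psum_unique => // [|p q|c|p].
  - exact: add_map_add ND (add_map_opp LD).
  - by rewrite raddfD hornerD FD.
  - by rewrite map_polyC hornerC /F !psumC.
  - rewrite rmorphM /= map_polyX hornerMX mulrC mulrDl FD mulNr.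
    by rewrite (add_mapN FD) FX FXC.
have /(congr1 F) := rhosE a f v.
rewrite (add_mapN FD) !(psubst_nat _ _ FD FX) => EF.
transitivity (psubst L (F \o (fun g : cdual V => (g v)%:P)) (rhos a f)).
  by apply: eq_psubstr => g; rewrite /F /= psumC.
by rewrite EF; congr (- _); apply: eq_psubstr => w; exact: FS.
Qed.

End DualRepresentation.

Section DualIsRepresentation.

Variables (K : fieldType) (R V : lmodType {poly K}).
Variables (br : R -> R -> {malg R[nat]}) (rho : R -> V -> {malg V[nat]}).
Variables (rhos : R -> cdual V -> {malg (cdual V)[nat]}).
Hypothesis rhosE : is_dual_representation rho rhos.

Variables (P : lmodType {poly K}) (one : P).
Hypothesis one_free : injective (fun p : {poly K} => p *: one).

(** [P] is a free module of rank one, in which the values of the functionals are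
    taken: the subscript of a functional becomes the derivation of [P], so that
    the operators on P[lambda] and P[lambda, mu] express identities between
    values. *)
Definition cdual_ev (v : V) (f : cdual V) : P := f v *: one.

Lemma cdual_evD v : add_map (cdual_ev v).
Proof. by move=> f g; rewrite /cdual_ev cdual_addE scalerDl. Qed.

Lemma cdual_ev_inj (I : choiceType) (p q : {malg (cdual V)[I]}) :
  (forall v, mapc (cdual_ev v) p = mapc (cdual_ev v) q) -> p = q.
Proof.
move=> pq; apply/malgP => k; apply: cdual_ext => v.
apply: one_free; rewrite /=.
by have /malgP/(_ k) := pq v; rewrite !(mcoeffc _ _ (cdual_evD v)).
Qed.

Lemma mapc_psubst (M N : lmodType {poly K}) (f : M -> N) p : add_map f ->
  mapc f p = psubst (@lam K N) (fun x => cstp (f x)) p.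
Proof.
move=> fD; have cD := add_map_comp fD (@cstpD K N).
move: p; apply: eq_add_malg => [||x k].
- exact: mapcD.
- exact: psubstD (@lamD K N) cD.
- rewrite mapcU // (psubstU (@lamD K N) cD) /=.
  by elim: k => //= k <-; rewrite /lam mshiftU.
Qed.

Let emb (c : K) : {malg P[nat]} := cstp (c%:P *: one).

Let embD : add_map emb.
Proof. by move=> x y; rewrite /emb polyCD scalerDl cstpD. Qed.

Let cstpE (p : {poly K}) : cstp (p *: one) = psum (@delp K P) emb p.
Proof.
move: p; apply: psum_unique => // [|p q|q].
- exact: delpD.
- by rewrite scalerDl cstpD.
- by rewrite mulrC /delp /cstp (mapcU (@delD K P)) /del scalerA.
Qed.

Let NLD : add_map (fun x : {malg P[nat]} => delp x - lam x).
Proof. exact: add_map_sub (@delpD K P) (@lamD K P). Qed.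

Let G (f : cdual V) (w : V) := psum (fun x => delp x - lam x) emb (f w).

Let GD f : add_map (G f).
Proof. by move=> w w'; rewrite /G cdual_appD psumD. Qed.

Let rhos_eval a f v :
  mapc (cdual_ev v) (rhos a f) = - psubst (@lam K P) (G f) (rho a v).
Proof.
rewrite mapc_psubst; last exact: cdual_evD.
rewrite -(dual_rep_op rhosE a f v (@lamD K P) (@delpD K P) embD); last first.
  by move=> w; rewrite /delp mapc_lam //; exact: delD.
by apply: eq_psubstr => g; exact: cstpE.
Qed.

Let scaleC (c : K) : add_map (fun x : P => c%:P *: x).
Proof. exact: scaleCD. Qed.

Let scaleV (c : K) : add_map (fun x : V => c%:P *: x).
Proof. exact: scaleCD. Qed.

Let scale_lam (c : K) (x : {malg P[nat]}) :
  mapc (fun x : P => c%:P *: x) (lam x) = lam (mapc (fun x : P => c%:P *: x) x).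
Proof. exact: mapc_lam. Qed.

Let GZ (c : K) (p : {poly K}) :
  psum (fun x => delp x - lam x) emb (c%:P * p) =
  mapc (fun x : P => c%:P *: x) (psum (fun x => delp x - lam x) emb p).
Proof.
have cD := mapcD (I := nat) (scaleC c).
apply: psumCM => // [w|d].
  rewrite (add_mapB cD (delp w) (lam w)) (scale_lam c w).
  rewrite (mapc_delp w (scaleC c)) // => x.
  by rewrite /del !scalerA mulrC.
by rewrite /emb /cstp mapcU // polyCM scalerA.
Qed.

Let evZ (c : K) v (p : {malg (cdual V)[nat]}) :
  mapc (cdual_ev v) (mapc (fun f => c%:P *: f) p) =
  mapc (fun x : P => c%:P *: x) (mapc (cdual_ev v) p).
Proof.
have [cD evD] := (@scaleCD K (cdual V) c, @cdual_evD v).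
rewrite !mapc_comp //; apply: eq_mapc => f /=.
by rewrite /cdual_ev cdual_scaleE comp_polyC scalerA.
Qed.

Let ev_delp v (p : {malg (cdual V)[nat]}) :
  mapc (cdual_ev v) (delp p) = - delp (mapc (cdual_ev v) p).
Proof.
apply/malgP => k; rewrite mcoeffN (mcoeffc _ _ (@cdual_evD v)) /delp.
rewrite !(mcoeffc _ _ (@delD K _)) (mcoeffc _ _ (@cdual_evD v)).
by rewrite /cdual_ev /del cdual_scaleE comp_polyX mulNr scaleNr scalerA.
Qed.

Lemma dual_bilinear : conf_bilinear rho -> conf_bilinear rhos.
Proof.
move=> rhoB; have lD := @lamD K P; have sD f := psubstD lD (@GD f).
split=> [a a' f|a f f'|c a f|c a f|a f|a f]; apply: cdual_ev_inj => v;
  have evD := @cdual_evD v; have eD := mapcD (I := nat) evD.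
- by rewrite eD !rhos_eval (conf_addl rhoB) sD opprD.
- rewrite eD !rhos_eval -opprD -psubst_addl //; congr (- _).
  by apply: eq_psubstr => w; rewrite /G cdual_addE psumD.
- rewrite evZ !rhos_eval (conf_scalel rhoB) (add_mapN (mapcD (scaleC c))).
  rewrite (psubst_nat _ _ (mapcD (scaleC c)) (scale_lam c)).
  rewrite (psubst_mapc (scaleV c) lD (@GD f)); congr (- _).
  by apply: eq_psubstr => w; rewrite /= /G cdual_appZ GZ.
- rewrite evZ !rhos_eval (add_mapN (mapcD (scaleC c))).
  rewrite (psubst_nat _ _ (mapcD (scaleC c)) (scale_lam c)); congr (- _).
  by apply: eq_psubstr => w; rewrite /= /G cdual_scaleE comp_polyC GZ.
- rewrite (add_mapN eD) mapc_lam // !rhos_eval (conf_dell rhoB).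
  by rewrite psubst_lamN // (add_mapN lD) !opprK.
- rewrite eD ev_delp mapc_lam //; pose N x := delp x - @lam K P x.
  have Nlam x : N (lam x) = lam (N x).
    by rewrite /N (add_mapB lD) /delp mapc_lam //; exact: delD.
  transitivity (- N (mapc (cdual_ev v) (rhos a f))); last first.
    by rewrite /N opprB addrC.
  have ND : add_map N := NLD; rewrite !rhos_eval (add_mapN ND) opprK.
  rewrite (psubst_nat _ _ ND Nlam) -psubst_oppl //; apply: eq_psubstr => w.
  rewrite /= /G cdual_scaleE comp_polyX mulNr (add_mapN (psumD NLD embD)) opprK.
  exact: psumXM.
Qed.

End DualIsRepresentation.

Section DualBracket.

Variables (K : fieldType) (R V : lmodType {poly K}).
Variables (br : R -> R -> {malg R[nat]}) (rho : R -> V -> {malg V[nat]}).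
Variables (rhos : R -> cdual V -> {malg (cdual V)[nat]}).
Hypothesis rhosE : is_dual_representation rho rhos.
Variables (P : lmodType {poly K}) (one : P).
Hypothesis one_free : injective (fun p : {poly K} => p *: one).

(** Dualizing reverses composition: [rho^*(a) (rho^*(b) f)] evaluated at [v] is
    [f] evaluated at [rho(b) (rho(a) v)], the two signs cancelling. *)
Lemma dual_comp (W : zmodType) (L1 L2 N : W -> W) (emb : K -> W) a b f v :
  add_map L1 -> add_map L2 -> add_map N -> add_map emb ->
  (forall w, L1 (N w) = N (L1 w)) -> (forall w, L2 (N w) = N (L2 w)) ->
  (forall w, L1 (L2 w) = L2 (L1 w)) ->
  psubst L2 (fun y : cdual V =>
    psubst L1 (fun g : cdual V => psum N emb (g v)) (rhos a y)) (rhos b f) =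
  psubst L1 (fun w => psubst L2 (fun w' =>
    psum (fun x => N x - L1 x - L2 x) emb (f w')) (rho b w)) (rho a v).
Proof.
move=> L1D L2D ND embD L1N L2N L12; have NL1 := add_map_sub ND L1D.
transitivity (psubst L2 (fun y : cdual V => - psubst L1 (fun w =>
    psum (fun x => N x - L1 x) emb (y w)) (rho a v)) (rhos b f)).
  by apply: eq_psubstr => y; exact: dual_rep_op.
rewrite psubst_oppl // psubst_exchange // -psubst_oppl //.
apply: eq_psubstr => w; rewrite (dual_rep_op rhosE) ?opprK // => x.
by rewrite (add_mapB L2D) L2N L12.
Qed.

Let N2 : {malg P[(nat * nat)%type]} -> {malg P[(nat * nat)%type]} :=
  mapc (@del K P).

Let emb2 (c : K) : {malg P[(nat * nat)%type]} := cstp2 (c%:P *: one).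

Let N2D : add_map N2. Proof. exact/mapcD/delD. Qed.

Let emb2D : add_map emb2.
Proof. by move=> x y; rewrite /emb2 polyCD scalerDl cstp2D. Qed.

Let lam2N x : lam2 (N2 x) = N2 (lam2 x).
Proof. by rewrite /N2 mapc_mshift //; exact: delD. Qed.

Let mu2N x : mu2 (N2 x) = N2 (mu2 x).
Proof. by rewrite /N2 mapc_mshift //; exact: delD. Qed.

Let lammu2N x : lammu2 (N2 x) = N2 (lammu2 x).
Proof. by rewrite /lammu2 N2D lam2N mu2N. Qed.

Let cstp2E (p : {poly K}) : cstp2 (p *: one) = psum N2 emb2 p.
Proof.
move: p; apply: psum_unique => // [p q|q].
- by rewrite scalerDl cstp2D.
- by rewrite mulrC /N2 /cstp2 (mapcU (@delD K P)) /del scalerA.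
Qed.

(** With [N2] in the role of nu, [Ev f] is w |-> f_(nu - lambda - mu)(w) on the
   coefficients in V. *)
Let N3 (x : {malg P[(nat * nat)%type]}) := N2 x - lam2 x - mu2 x.

Let N3D : add_map N3. Proof. exact/add_map_sub/mu2D/add_map_sub/lam2D/N2D. Qed.

Let H (f : cdual V) (w : V) := psum N3 emb2 (f w).

Let HD f : add_map (H f).
Proof. by move=> w w'; rewrite /H cdual_appD psumD. Qed.

Let hev f (k : nat * nat) (w : V) :=
  iter k.1 (@lam2 K P) (iter k.2 (@mu2 K P) (H f w)).

Let hevD f k : add_map (hev f k).
Proof.
by move=> x y; rewrite /hev HD !add_map_iter //; [exact: lam2D | exact: mu2D].
Qed.

Let Ev f : {malg V[(nat * nat)%type]} -> {malg P[(nat * nat)%type]} :=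
  msum (hev f).

Let EvD f : add_map (Ev f). Proof. exact/msumD. Qed.

Let Ev_cstp2 f w : Ev f (cstp2 w) = H f w.
Proof. exact: msumU. Qed.

Let Ev_lam2 f p : Ev f (lam2 p) = lam2 (Ev f p).
Proof.
move: p; apply: eq_add_malg => [||x k].
- exact: add_map_comp (@lam2D K V) (EvD f).
- exact: add_map_comp (EvD f) (@lam2D K P).
- by rewrite /lam2 mshiftU /Ev !msumU.
Qed.

Let Ev_mu2 f p : Ev f (mu2 p) = mu2 (Ev f p).
Proof.
move: p; apply: eq_add_malg => [||x k].
- exact: add_map_comp (@mu2D K V) (EvD f).
- exact: add_map_comp (EvD f) (@mu2D K P).
- rewrite /mu2 mshiftU /Ev !msumU // /hev /=.
  by apply/esym/iter_swap => w; rewrite lam2_mu2.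
Qed.

Let Ev_lammu2 f p : Ev f (lammu2 p) = lammu2 (Ev f p).
Proof. by rewrite /lammu2 EvD Ev_lam2 Ev_mu2. Qed.

Let ev_cstp2 v (f : cdual V) :
  mapc (cdual_ev one v) (cstp2 f) = psum N2 emb2 (f v).
Proof. by rewrite -cstp2E /cstp2 mapcU //; exact: cdual_evD. Qed.

Let evs v : add_map
  (fun p : {malg (cdual V)[(nat * nat)%type]} => mapc (cdual_ev one v) p).
Proof. exact/mapcD/cdual_evD. Qed.

Let ev_lam2 v (p : {malg (cdual V)[(nat * nat)%type]}) :
  mapc (cdual_ev one v) (lam2 p) = lam2 (mapc (cdual_ev one v) p).
Proof. by rewrite mapc_mshift //; exact: cdual_evD. Qed.

Let ev_mu2 v (p : {malg (cdual V)[(nat * nat)%type]}) :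
  mapc (cdual_ev one v) (mu2 p) = mu2 (mapc (cdual_ev one v) p).
Proof. by rewrite mapc_mshift //; exact: cdual_evD. Qed.

Let ev_lammu2 v (p : {malg (cdual V)[(nat * nat)%type]}) :
  mapc (cdual_ev one v) (lammu2 p) = lammu2 (mapc (cdual_ev one v) p).
Proof. by rewrite /lammu2 evs ev_lam2 ev_mu2. Qed.

Let ev_lam_mu a b f v : mapc (cdual_ev one v) (comp_lam_mu rhos rhos a b f) =
  Ev f (comp_mu_lam rho rho b a v).
Proof.
rewrite (psubst_nat _ _ (evs v) (ev_mu2 v)).
rewrite (psubst_nat _ _ (EvD f) (Ev_lam2 f)).
transitivity (psubst (@mu2 K P) (fun y : cdual V => psubst (@lam2 K P)
    (fun g : cdual V => psum N2 emb2 (g v)) (rhos a y)) (rhos b f)).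
  apply: eq_psubstr => y /=; rewrite (psubst_nat _ _ (evs v) (ev_lam2 v)).
  by apply: eq_psubstr => g /=; exact: ev_cstp2.
rewrite dual_comp //; try by [exact: lam2D | exact: mu2D | exact: lam2_mu2].
apply: eq_psubstr => w /=; rewrite (psubst_nat _ _ (EvD f) (Ev_mu2 f)).
by apply: eq_psubstr => w' /=; rewrite Ev_cstp2.
Qed.

Let ev_mu_lam a b f v : mapc (cdual_ev one v) (comp_mu_lam rhos rhos b a f) =
  Ev f (comp_lam_mu rho rho a b v).
Proof.
rewrite (psubst_nat _ _ (evs v) (ev_lam2 v)).
rewrite (psubst_nat _ _ (EvD f) (Ev_mu2 f)).
transitivity (psubst (@lam2 K P) (fun y : cdual V => psubst (@mu2 K P)
    (fun g : cdual V => psum N2 emb2 (g v)) (rhos b y)) (rhos a f)).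
  apply: eq_psubstr => y /=; rewrite (psubst_nat _ _ (evs v) (ev_mu2 v)).
  by apply: eq_psubstr => g /=; exact: ev_cstp2.
rewrite dual_comp //; try by
  [exact: lam2D | exact: mu2D | move=> x; rewrite lam2_mu2].
apply: eq_psubstr => w /=; rewrite (psubst_nat _ _ (EvD f) (Ev_lam2 f)).
apply: eq_psubstr => w' /=; rewrite Ev_cstp2; apply: eq_psum => // x.
by rewrite /N3 addrAC.
Qed.

Let ev_sum a b f v : mapc (cdual_ev one v) (comp_lam_sum rhos br a b f) =
  - Ev f (comp_lam_sum rho br a b v).
Proof.
rewrite (psubst_nat _ _ (evs v) (ev_lam2 v)).
rewrite (psubst_nat _ _ (EvD f) (Ev_lam2 f)) -psubst_oppl; last exact: lam2D.
apply: eq_psubstr => y /=; rewrite (psubst_nat _ _ (evs v) (ev_lammu2 v)).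
rewrite (psubst_nat _ _ (EvD f) (Ev_lammu2 f)).
transitivity (psubst (@lammu2 K P)
    (fun g : cdual V => psum N2 emb2 (g v)) (rhos y f)).
  by apply: eq_psubstr => g /=; exact: ev_cstp2.
rewrite (dual_rep_op rhosE) //; last exact: lammu2D.
congr (- _); apply: eq_psubstr => w /=; rewrite Ev_cstp2.
by apply: eq_psum => // x; rewrite /N3 /lammu2 opprD addrA.
Qed.

(** Evaluated at [v] in the variable nu, each of the three terms of the identity
    for [rhos] is plus or minus [f_(nu - lambda - mu)] of the corresponding term
    of the identity for [rho] at [v], the two composites being exchanged. *)
Lemma dual_representation_over :
  is_representation br rho -> is_representation br rhos.
Proof.
move=> rhoR; split.
  exact (dual_bilinear rhosE one_free (rep_bilinear rhoR)).
move=> a b f; apply: (cdual_ev_inj one_free) => v.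
rewrite (add_mapB (evs v)) ev_sum ev_lam_mu ev_mu_lam (rep_bracket rhoR).
by rewrite (add_mapB (EvD f)) opprB.
Qed.

End DualBracket.

Lemma dual_representation (K : fieldType) (R V : lmodType {poly K})
    (br : R -> R -> {malg R[nat]}) (rho : R -> V -> {malg V[nat]})
    (rhos : R -> cdual V -> {malg (cdual V)[nat]}) :
  is_dual_representation rho rhos ->
  is_representation br rho -> is_representation br rhos.
Proof.
move=> rhosE; apply: (@dual_representation_over K R V br rho rhos rhosE
  ({poly K}^o : lmodType {poly K}) (1 : {poly K})).
by move=> p q; rewrite /= [LHS]mulr1 [RHS]mulr1.
Qed.

(** * Left symmetry from an O-operator *)

Lemma subr_exchange (W : zmodType) (a b c d : W) :
  a - b = c - d -> a - c = b - d.
Proof.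
move/(canRL (subrK _)) ->.
by rewrite addrAC [c - d - c]addrAC subrr add0r addrC.
Qed.

Section LeftSymmetry.

Variables (K : fieldType) (R V M : lmodType {poly K}).
Variables (br : R -> R -> {malg R[nat]}) (rho : R -> V -> {malg V[nat]}).
Variables (T : {linear V -> R}) (sigma : R -> M -> {malg M[nat]}).
Hypotheses (TO : is_O_operator br rho T) (sigmaR : is_representation br sigma).

Lemma raddf_add_map (A B : lmodType {poly K}) (f : {linear A -> B}) : add_map f.
Proof. by move=> x y; rewrite linearD. Qed.

Lemma linear_del (A B : lmodType {poly K}) (f : {linear A -> B}) x :
  f (del x) = del (f x).
Proof. by rewrite /del linearZ. Qed.

Lemma conf0r (A B C : lmodType {poly K}) (f : A -> B -> {malg C[nat]}) a :
  conf_bilinear f -> f a 0 = 0.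
Proof. by move=> fB; apply: (add_map0 (conf_addr fB a)). Qed.

Lemma conf0l (A B C : lmodType {poly K}) (f : A -> B -> {malg C[nat]}) b :
  conf_bilinear f -> f 0 b = 0.
Proof.
by move=> fB; apply: (@add_map0 _ _ (f^~ b)) => x y; rewrite (conf_addl fB).
Qed.

(** The left-symmetry identity with values in an arbitrary representation: the
    product [T u * T w] is [T (rho (T u) w)], and the skew-symmetrized product
    is the bracket by the O-operator identity. *)
Lemma left_symmetric_action u w z :
  psubst (@lam2 K M) (fun y =>
    psubst (@lammu2 K M) (@cstp2 K M) (sigma (T y) z)) (rho (T u) w) -
  comp_lam_mu sigma sigma (T u) (T w) z =
  psubst (@mu2 K M) (fun y =>
    psubst (@lammu2 K M) (@cstp2 K M) (sigma (T y) z)) (rho (T w) u) -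
  comp_mu_lam sigma sigma (T w) (T u) z.
Proof.
have sB := rep_bilinear sigmaR; have TD := raddf_add_map T.
have [lD mD] := (@lam2D K M, @mu2D K M); have lmD := @lammu2D K M.
pose g y := psubst (@lammu2 K M) (@cstp2 K M) (sigma y z).
have gD : add_map g.
  move=> y y'; rewrite /g (conf_addl sB).
  exact: psubstD lmD (@cstp2D K M) _ _.
have gT : add_map (fun y => g (T y)) := add_map_comp TD gD.
have sumE : comp_lam_sum sigma br (T u) (T w) z =
    psubst (@lam2 K M) (fun y => g (T y)) (rho (T u) w) -
    psubst (@mu2 K M) (fun y => g (T y)) (rho (T w) u).
  rewrite /comp_lam_sum TO psubst_mapc // (add_mapB (psubstD lD gT)).
  congr (_ - _).
  (* d acts through [g] by -(lambda + mu), so -lambda - d becomes mu. *)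
  rewrite (@psubst_refl _ _ _ _ _ lD gT (fun x => - lammu2 x)).
  - apply: eq_psubst => // x.
    by rewrite opprK /lammu2 addrA addNr add0r.
  - exact: add_map_opp.
  - move=> x; rewrite linear_del /g (conf_dell sB) psubst_lamN //.
    exact: cstp2D.
  - by move=> x; rewrite (add_mapN lD) lam2_lammu2.
have := rep_bracket sigmaR (T u) (T w) z; rewrite sumE; exact: subr_exchange.
Qed.

End LeftSymmetry.

(** * The left-symmetric algebra on the image of an O-operator *)

Section ImageModule.

Variables (K : fieldType) (R V : lmodType {poly K}) (T : {linear V -> R}).

Lemma to_imgP (x : img T) : exists u, x = to_img T u.
Proof.
by have /asboolP[u Tu] := img_valP x; exists u; apply: val_inj.
Qed.

Lemma to_imgD : add_map (to_img T).
Proof. by move=> u w; apply: val_inj; rewrite /= linearD. Qed.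

Lemma to_imgZ p u : to_img T (p *: u) = p *: to_img T u.
Proof. by apply: val_inj; rewrite /= linearZ. Qed.

Lemma to_img_del u : to_img T (del u) = del (to_img T u).
Proof. exact: to_imgZ. Qed.

Lemma img_valD : add_map (@img_val _ _ _ T).
Proof. by []. Qed.

End ImageModule.

Section ImageProduct.

Variables (K : fieldType) (R V : lmodType {poly K}).
Variables (rho : R -> V -> {malg V[nat]}).
Variables (T : {linear V -> R}) (pT : img T -> img T -> {malg (img T)[nat]}).
Hypothesis pTE : forall u w : V,
  pT (to_img T u) (to_img T w) = mapc (to_img T) (rho (T u) w).

Lemma image_product_bilinear : conf_bilinear rho -> conf_bilinear pT.
Proof.
move=> rhoB; have [iD TD] := (to_imgD T, raddf_add_map T).
have iS := mapcD (I := nat) iD.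
split=> [x x' y|x y y'|c x y|c x y|x y|x y];
  have [u ->] := to_imgP x; have [w ->] := to_imgP y.
- have [u' ->] := to_imgP x'; rewrite -iD !pTE TD (conf_addl rhoB); exact: iS.
- have [w' ->] := to_imgP y'; rewrite -iD !pTE (conf_addr rhoB); exact: iS.
- rewrite -to_imgZ !pTE linearZ (conf_scalel rhoB) mapc_scale // => w'.
  exact: to_imgZ.
- rewrite -to_imgZ !pTE (conf_scaler rhoB) mapc_scale // => w'.
  exact: to_imgZ.
- rewrite -to_img_del !pTE linear_del (conf_dell rhoB) (add_mapN iS).
  by rewrite mapc_lam.
- rewrite -to_img_del !pTE (conf_delr rhoB).
  rewrite (iS (delp (rho (T u) w)) (lam (rho (T u) w))) (mapc_lam _ iD).
  by rewrite (mapc_delp _ iD (@to_img_del _ _ _ T)).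
Qed.

End ImageProduct.

Section Pairs.

Variables (K : fieldType) (M N : lmodType {poly K}).

Definition inl_pair (x : M) : M * N := (x, 0).
Definition inr_pair (y : N) : M * N := (0, y).

Fact inl_pair_linear : linear inl_pair.
Proof.
by move=> p x y; congr (_, _); apply/esym; exact: etrans (addr0 _) (scaler0 _ _).
Qed.

Fact inr_pair_linear : linear inr_pair.
Proof.
by move=> p x y; congr (_, _); apply/esym; exact: etrans (addr0 _) (scaler0 _ _).
Qed.

HB.instance Definition _ :=
  GRing.isLinear.Build {poly K} N (M * N)%type _ inr_pair inr_pair_linear.

End Pairs.

Arguments inl_pair {K M N} x.
Arguments inr_pair {K M N} y.

Section SemidirectProduct.

Variables (K : fieldType) (R V : lmodType {poly K}).
Variables (rho : R -> V -> {malg V[nat]}).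
Variables (rhos : R -> cdual V -> {malg (cdual V)[nat]}).
Variables (T : {linear V -> R}) (pT : img T -> img T -> {malg (img T)[nat]}).
Hypotheses (pTE : forall u w : V,
  pT (to_img T u) (to_img T w) = mapc (to_img T) (rho (T u) w)).
Hypotheses (rhoB : conf_bilinear rho) (rhosB : conf_bilinear rhos).

Local Notation A := (img T * cdual V)%type.
Local Notation pA := (semidirect_product pT rhos).

Let inlD : add_map (@inl_pair K (img T) (cdual V)).
Proof. exact/linear_add_map/inl_pair_linear. Qed.

Let inrD : add_map (@inr_pair K (img T) (cdual V)).
Proof. exact/linear_add_map/inr_pair_linear. Qed.

Lemma fst_add : add_map (fun x : A => x.1). Proof. by []. Qed.
Lemma snd_add : add_map (fun x : A => x.2). Proof. by []. Qed.

Lemma semidirect_fst x y : mapc (fun x : A => x.1) (pA x y) = pT x.1 y.1.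
Proof.
apply/malgP => k.
rewrite (mcoeffc _ _ fst_add) mcoeffD.
by rewrite (mcoeffc _ _ inlD) (mcoeffc _ _ inrD) /= addr0.
Qed.

Lemma semidirect_snd x y : mapc (fun x : A => x.2) (pA x y) = rhos x.1 y.2.
Proof.
apply/malgP => k.
rewrite (mcoeffc _ _ snd_add) mcoeffD.
by rewrite (mcoeffc _ _ inlD) (mcoeffc _ _ inrD) /= add0r.
Qed.

Lemma semidirect_ext (I : choiceType) (p q : {malg A[I]}) :
  mapc (fun x : A => x.1) p = mapc (fun x : A => x.1) q ->
  mapc (fun x : A => x.2) p = mapc (fun x : A => x.2) q -> p = q.
Proof.
move=> /malgP p1 /malgP p2; apply/malgP => k.
have := p1 k; have := p2 k; rewrite !(mcoeffc _ _ fst_add) !(mcoeffc _ _ snd_add).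
by case: (p@_k) (q@_k) => [a f] [b g] /= -> ->.
Qed.

Lemma semidirect_bilinear : conf_bilinear pA.
Proof.
have pTB := image_product_bilinear pTE rhoB.
have [f1 f2] := (mapcD (I := nat) fst_add, mapcD (I := nat) snd_add).
(* Only the two components of the product matter from here on. *)
move: (semidirect_product pT rhos) semidirect_fst semidirect_snd => p p1 p2.
split=> [x x' y|x y y'|c x y|c x y|x y|x y]; apply: semidirect_ext.
- by rewrite (f1 (p x y)) !p1 (conf_addl pTB).
- by rewrite (f2 (p x y)) !p2 (conf_addl rhosB).
- by rewrite (f1 (p x y)) !p1 (conf_addr pTB).
- by rewrite (f2 (p x y)) !p2 (conf_addr rhosB).
- by rewrite mapc_scale // !p1 (conf_scalel pTB).
- by rewrite mapc_scale // !p2 (conf_scalel rhosB).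
- by rewrite mapc_scale // !p1 (conf_scaler pTB).
- by rewrite mapc_scale // !p2 (conf_scaler rhosB).
- rewrite (add_mapN f1 (lam (p x y))) (mapc_lam _ fst_add) !p1.
  exact: conf_dell.
- rewrite (add_mapN f2 (lam (p x y))) (mapc_lam _ snd_add) !p2.
  exact: conf_dell.
- rewrite (f1 (delp (p x y))) (mapc_lam _ fst_add).
  rewrite (@mapc_delp _ _ _ (fun x : A => x.1) _ fst_add (fun _ => erefl)).
  rewrite !p1; exact: conf_delr.
- rewrite (f2 (delp (p x y))) (mapc_lam _ snd_add).
  rewrite (@mapc_delp _ _ _ (fun x : A => x.2) _ snd_add (fun _ => erefl)).
  rewrite !p2; exact: conf_delr.
Qed.

End SemidirectProduct.

Section TwoVariables.

Variables (K : fieldType) (M N : lmodType {poly K}) (f : M -> N).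
Hypothesis fD : add_map f.
Local Notation mapf := (@mapc _ M N (nat * nat)%type f).

Lemma mapc_lam2 p : mapf (lam2 p) = lam2 (mapf p).
Proof. exact: mapc_mshift. Qed.

Lemma mapc_mu2 p : mapf (mu2 p) = mu2 (mapf p).
Proof. exact: mapc_mshift. Qed.

Lemma mapc_lammu2 p : mapf (lammu2 p) = lammu2 (mapf p).
Proof. by rewrite /lammu2 (mapcD fD) mapc_lam2 mapc_mu2. Qed.

Lemma mapc_psubst2 (B : lmodType {poly K})
    (Phi Psi : {malg M[(nat * nat)%type]} -> {malg M[(nat * nat)%type]})
    (Phi' Psi' : {malg N[(nat * nat)%type]} -> {malg N[(nat * nat)%type]})
    (g : B -> {malg M[nat]}) (g' : B -> {malg N[nat]}) p :
  (forall q, mapf (Phi q) = Phi' (mapf q)) ->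
  (forall q, mapf (Psi q) = Psi' (mapf q)) -> add_map Psi' ->
  (forall y, mapc f (g y) = g' y) ->
  mapf (psubst Phi (fun y => psubst Psi (@cstp2 K M) (g y)) p) =
  psubst Phi' (fun y => psubst Psi' (@cstp2 K N) (g' y)) p.
Proof.
move=> fPhi fPsi PsiD gg; rewrite (psubst_nat _ _ (mapcD fD) fPhi).
apply: eq_psubstr => y /=; rewrite (psubst_nat _ _ (mapcD fD) fPsi) -gg.
rewrite (psubst_mapc fD PsiD (@cstp2D K N)).
by apply: eq_psubstr => x /=; rewrite /cstp2 mapcU.
Qed.

End TwoVariables.

Section SemidirectLeftSymmetric.

Variables (K : fieldType) (R V : lmodType {poly K}).
Variables (br : R -> R -> {malg R[nat]}) (rho : R -> V -> {malg V[nat]}).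
Variables (rhos : R -> cdual V -> {malg (cdual V)[nat]}).
Variables (T : {linear V -> R}) (pT : img T -> img T -> {malg (img T)[nat]}).
Hypotheses (pTE : forall u w : V,
  pT (to_img T u) (to_img T w) = mapc (to_img T) (rho (T u) w)).
Hypotheses (TO : is_O_operator br rho T).
Hypotheses (rhoR : is_representation br rho).
Hypotheses (rhosR : is_representation br rhos).

Local Notation A := (img T * cdual V)%type.
Local Notation pA := (semidirect_product pT rhos).

Let rhoB := rep_bilinear rhoR.
Let rhosB := rep_bilinear rhosR.
Let pTB := image_product_bilinear pTE rhoB.

Let rhosTB : conf_bilinear (fun t : img T => rhos (img_val t)).
Proof.
split=> [x x' y|x y y'|c x y|c x y|x y|x y].
- exact: (conf_addl rhosB).
- exact: (conf_addr rhosB).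
- exact: (conf_scalel rhosB).
- exact: (conf_scaler rhosB).
- exact: (conf_dell rhosB).
- exact: (conf_delr rhosB).
Qed.

(** Through a projection of [A], the iterated products of [pA] become those of
   the action [s] of the image on the target. *)
Let component (M : lmodType {poly K}) (f : A -> M)
    (s : img T -> M -> {malg M[nat]}) x y z : conf_bilinear s ->
  add_map f -> (forall t t', mapc f (pA t t') = s t.1 (f t')) ->
  mapc f (comp_lam_sum pA pA x y z - comp_lam_mu pA pA x y z) =
    psubst (@lam2 K M) (fun t => psubst (@lammu2 K M) (@cstp2 K M) (s t (f z)))
      (pT x.1 y.1) - comp_lam_mu s s x.1 y.1 (f z) /\
  mapc f (comp_mu_sum pA pA y x z - comp_mu_lam pA pA y x z) =
    psubst (@mu2 K M) (fun t => psubst (@lammu2 K M) (@cstp2 K M) (s t (f z)))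
      (pT y.1 x.1) - comp_mu_lam s s y.1 x.1 (f z).
Proof.
move=> sB fD fE.
have sumD : add_map (fun t => psubst (@lammu2 K M) (@cstp2 K M) (s t (f z))).
  move=> t t'; rewrite (conf_addl sB).
  by apply: psubstD; [exact: lammu2D | exact: cstp2D].
have innerD Phi t : add_map Phi ->
    add_map (fun y => psubst Phi (@cstp2 K M) (s t y)).
  move=> PD y1 y2; rewrite (conf_addr sB).
  by apply: psubstD; last exact: cstp2D.
have f1 := mapc_lam2 fD; have f2 := mapc_mu2 fD; have f3 := mapc_lammu2 fD.
have lD := @lam2D K M; have mD := @mu2D K M; have lmD := @lammu2D K M.
have subE p q := add_mapB (mapcD (I := (nat * nat)%type) fD) p q.
split; apply: etrans (subE _ _) _; congr (_ - _).
- apply: etrans (mapc_psubst2 fD (g' := fun t => s t.1 (f z)) _ f1 f3 lmD _) _.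
    by move=> t; rewrite fE.
  rewrite -(semidirect_fst rhos pT x y).
  by rewrite (psubst_mapc (@fst_add _ _ _ T) lD sumD).
- apply: etrans (mapc_psubst2 fD (g' := fun t => s x.1 (f t)) _ f2 f1 lD _) _.
    by move=> t; rewrite fE.
  by rewrite /comp_lam_mu -fE (psubst_mapc fD mD (innerD _ _ lD)).
- apply: etrans (mapc_psubst2 fD (g' := fun t => s t.1 (f z)) _ f2 f3 lmD _) _.
    by move=> t; rewrite fE.
  rewrite -(semidirect_fst rhos pT y x).
  by rewrite (psubst_mapc (@fst_add _ _ _ T) mD sumD).
- apply: etrans (mapc_psubst2 fD (g' := fun t => s y.1 (f t)) _ f1 f2 mD _) _.
    by move=> t; rewrite fE.
  by rewrite /comp_mu_lam -fE (psubst_mapc fD lD (innerD _ _ mD)).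
Qed.

(** The two components of the identity are [left_symmetric_action] for [rho],
    transported by [T], and for the dual representation. *)
Lemma semidirect_left_symmetric : is_left_symmetric_conformal pA.
Proof.
split; first exact: semidirect_bilinear.
move=> x y z; have [u xu] := to_imgP x.1; have [w yw] := to_imgP y.1.
have TD := to_imgD T.
apply: semidirect_ext.
- have [E1 E2] := component x y z pTB (@fst_add _ _ _ T)
    (semidirect_fst rhos pT).
  apply: etrans E1 _; apply: etrans (esym E2).
  have [c zc] := to_imgP z.1; rewrite /= xu yw zc !pTE.
  have t1 := mapc_lam2 TD; have t2 := mapc_mu2 TD; have t3 := mapc_lammu2 TD.
  have lmu := @lammu2D K (img T).
  have sumD : add_map (fun t => psubst (@lammu2 K (img T)) (@cstp2 K (img T))
      (pT t (to_img T c))).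
    move=> t t'; rewrite (conf_addl pTB).
    by apply: psubstD => //; exact: cstp2D.
  rewrite (psubst_mapc TD (@lam2D K (img T)) sumD).
  rewrite (psubst_mapc TD (@mu2D K (img T)) sumD).
  have innerD Phi t : add_map Phi ->
      add_map (fun y => psubst Phi (@cstp2 K (img T)) (pT t y)).
    move=> PD y1 y2; rewrite (conf_addr pTB).
    by apply: psubstD; last exact: cstp2D.
  have inner a b : mapc (to_img T) (rho (T a) b) = pT (to_img T a) (to_img T b).
    by rewrite pTE.
  rewrite -(mapc_psubst2 TD _ t1 t3 lmu (inner^~ c)).
  rewrite -(mapc_psubst2 TD _ t2 t3 lmu (inner^~ c)).
  rewrite /comp_lam_mu /comp_mu_lam !pTE.
  rewrite (psubst_mapc TD (@mu2D K _) (innerD _ _ (@lam2D K _))).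
  rewrite (psubst_mapc TD (@lam2D K _) (innerD _ _ (@mu2D K _))).
  rewrite -(mapc_psubst2 TD _ t2 t1 (@lam2D K _) (inner u)).
  rewrite -(mapc_psubst2 TD _ t1 t2 (@mu2D K _) (inner w)).
  have subE p q := esym (add_mapB (mapcD (I := (nat * nat)%type) TD) p q).
  apply: etrans (subE _ _) _; apply: etrans (esym (subE _ _)).
  by congr mapc; exact: left_symmetric_action TO rhoR u w c.
- have [E1 E2] := component x y z rhosTB (@snd_add _ _ _ T)
    (semidirect_snd rhos pT).
  apply: etrans E1 _; apply: etrans (esym E2).
  rewrite xu yw !pTE.
  have sumD : add_map (fun t : img T =>
      psubst (@lammu2 K _) (@cstp2 K _) (rhos t z.2)).
    move=> t t'; rewrite (conf_addl rhosB).
    by apply: psubstD; [exact: lammu2D | exact: cstp2D].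
  rewrite (psubst_mapc TD (@lam2D K _) sumD) (psubst_mapc TD (@mu2D K _) sumD).
  exact: (left_symmetric_action TO rhosR u w z.2).
Qed.

End SemidirectLeftSymmetric.

(** * Tensor products over a field *)

Section TensorProducts.

Variable K : fieldType.
Implicit Types U V W : lmodType K.

Lemma linear_oppB U V (f g : U -> V) :
  linear f -> linear g -> linear (fun x => - f x - g x).
Proof.
move=> fL gL c x y; rewrite fL gL scalerBr scalerN !opprD.
by rewrite addrACA.
Qed.

Lemma tlift_add U V W (phi : U -> V -> W) : bilin phi -> add_map (tlift phi).
Proof. by move=> phiB; exact: linear_add_map (tlift_linear phiB). Qed.

Lemma tmap_linear U V U' V' (f : U -> U') (g : V -> V') :
  linear f -> linear g -> linear (tmap f g).
Proof. by move=> fL gL; exact: tlift_linear (tmap_bilin fL gL). Qed.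

Lemma eq_add_tensor U V (W : zmodType) (F G : tensor U V -> W) :
  add_map F -> add_map G -> (forall u v, F (u ⊗ v) = G (u ⊗ v)) -> F =1 G.
Proof.
move=> FD GD FG z; have [s ->] := tensor_span z.
rewrite (add_map_sum FD) (add_map_sum GD); apply: eq_bigr => x _; exact: FG.
Qed.

(** How a bilinear expression in the factors is seen to depend on the tensor
    only. *)
Lemma tensor_sum_ext U V W (phi : U -> V -> W) (s s' : seq (U * V)) :
  bilin phi -> \sum_(x <- s) x.1 ⊗ x.2 = \sum_(x <- s') x.1 ⊗ x.2 ->
  \sum_(x <- s) phi x.1 x.2 = \sum_(x <- s') phi x.1 x.2.
Proof.
move=> phiB /(congr1 (tlift phi)); rewrite !(add_map_sum (tlift_add phiB)).
under eq_bigr => x _ do rewrite tlift_pure //.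
by under [in X in _ = X -> _]eq_bigr => x _ do rewrite tlift_pure //.
Qed.

Lemma tpure_addl U V (v : V) : add_map (fun u : U => u ⊗ v).
Proof. by move=> u u'; exact: tpureDl. Qed.

Lemma tpure_addr U V (u : U) : add_map (fun v : V => u ⊗ v).
Proof. by move=> v v'; exact: tpureDr. Qed.

(** A tensor with linearly dependent second factors can be written with one
    term less. *)
Lemma tensor_free_span U V (z : tensor U V) :
  exists N (x : 'I_N -> U) (y : 'I_N -> V), z = \sum_i x i ⊗ y i /\
    forall c : 'I_N -> K, \sum_i c i *: y i = 0 -> forall i, c i = 0.
Proof.
have [s sE] := tensor_span z.
have : exists N (x : 'I_N -> U) (y : 'I_N -> V), z = \sum_i x i ⊗ y i.
  exists (size s), (fun i => (tnth (in_tuple s) i).1),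
    (fun i => (tnth (in_tuple s) i).2).
  by rewrite sE big_tnth.
move=> {s sE} [N]; elim: N => [|N IH] [x [y zE]].
  by exists 0%N, x, y; split=> // c _ [].
have [yF|] := pselect (forall c : 'I_N.+1 -> K,
    \sum_i c i *: y i = 0 -> forall i, c i = 0); first by exists N.+1, x, y.
move=> /existsNP[c /not_implyP[cy /existsNP[k /eqP ck]]]; apply: IH.
exists (fun i => x (lift k i) - (c (lift k i) / c k) *: x k), (y \o lift k).
have yk : y k = - \sum_i (c (lift k i) / c k) *: y (lift k i).
  move/eqP: cy; rewrite (bigD1_ord k) //= addr_eq0 => /eqP cy.
  rewrite -[y k]scale1r -(mulVf ck) -scalerA cy scalerN scaler_sumr.
  by congr (- _); apply: eq_bigr => i _; rewrite scalerA mulrC.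
rewrite zE (bigD1_ord k) //= {1}yk addrC (add_mapN (@tpure_addr _ _ (x k))).
rewrite (add_map_sum (@tpure_addr _ _ (x k))) -sumrB; apply: eq_bigr => i _ /=.
by rewrite (add_mapB (@tpure_addl _ _ _)) tpureZl tpureZr.
Qed.

Definition separated U : Prop := forall u : U,
  (forall phi : U -> K^o, linear phi -> phi u = 0) -> u = 0.

(** Linear injections have injective tensor products: write an element of the
    kernel with independent second factors and contract the first ones with
    linear functionals. *)
Lemma tmap_inj U V U' V' (f : U -> U') (g : V -> V') :
  linear f -> linear g -> injective f -> injective g -> separated U' ->
  injective (tmap f g).
Proof.
move=> fL gL fI gI sepU; have mD := linear_add_map (tmap_linear fL gL).
have [fD gD] := (linear_add_map fL, linear_add_map gL).
suff ker0 z : tmap f g z = 0 -> z = 0.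
  move=> z z' /eqP; rewrite -subr_eq0 -(add_mapB mD) => /eqP /ker0 /eqP.
  by rewrite subr_eq0 => /eqP.
have [N [x [y [-> yF]]]] := tensor_free_span z.
rewrite (add_map_sum mD) => fg0; rewrite big1 // => i _.
suff -> : x i = 0 by rewrite (add_map0 (@tpure_addl _ _ _)).
apply: fI; rewrite (add_map0 fD); apply: sepU => phi phiL.
have phiD := linear_add_map phiL.
pose ev (u : U') (v : V') := (phi u : K) *: v.
have evB : bilin ev.
  split=> *; rewrite /ev ?phiD ?(linear_scale phiL) ?scalerDl ?scalerDr //.
    by rewrite scalerA.
  by rewrite !scalerA mulrC.
apply: (yF (fun i => phi (f (x i)))); apply: gI; rewrite (add_map0 gD).
rewrite (add_map_sum gD) -[RHS](add_map0 (tlift_add evB)) -[in RHS]fg0.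
rewrite (add_map_sum (tlift_add evB)); apply: eq_bigr => j _.
by rewrite tmap_pure // tlift_pure // (linear_scale gL).
Qed.

End TensorProducts.

Section Separation.

Variables (K : fieldType) (R V : lmodType {poly K}).
Variables (n : nat) (e : 'I_n -> R).
Hypothesis eB : is_basis e.

Lemma basis_coordinates : exists c : R -> 'I_n -> {poly K},
  [/\ forall x, x = \sum_j c x j *: e j,
      forall x y j, c (x + y) j = c x j + c y j &
      forall p x j, c (p *: x) j = p * c x j].
Proof.
have [c cE] := choice eB.
have cu x d : x = \sum_j d j *: e j -> forall j, c x j = d j.
  move=> xd j; have [_ /(_ (finfun d))] := cE x.
  rewrite {1}xd => -> //; first by rewrite ffunE.
  by apply: eq_bigr => i _; rewrite ffunE.
exists (fun x j => c x j).
have cx x : x = \sum_j c x j *: e j by have [] := cE x.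
split=> // [x y j|p x j].
  apply: (cu _ (fun j => c x j + c y j)).
  rewrite {1}[x]cx {1}[y]cx -big_split.
  by apply: eq_bigr => i _; rewrite scalerDl.
apply: (cu _ (fun j => p * c x j)).
by rewrite {1}[x]cx scaler_sumr; apply: eq_bigr => i _; rewrite scalerA.
Qed.

(** The coefficients of the coordinates in [R] and those of the values of a
    functional are linear functionals over [K]. *)
Lemma free_separated : separated (restr (R * cdual V)%type).
Proof.
have [c [cE cD cZ]] := basis_coordinates.
move=> [x f] x0; congr (_, _).
  rewrite [x]cE big1 // => j _; suff -> : c x j = 0 by rewrite scale0r.
  apply/polyP => l; rewrite coef0.
  apply: (x0 (fun u => (c u.1 j)`_l)) => k y z.
  by rewrite cD cZ coefD coefCM.
apply: cdual_ext => v; apply/polyP => l; rewrite coef0.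
apply: (x0 (fun u => (u.2 v)`_l)) => k y z.
by rewrite cdual_addE cdual_scaleE comp_polyC coefD coefCM.
Qed.

End Separation.

(** * The S-equation modulo total derivatives *)

Section TensorDerivations.

Variables (K : fieldType) (A : lmodType {poly K}).
Local Notation W3 := (tensor3 A).

(** Linearity over [K] only, for maps defined on a K[d]-module. *)
Definition klin (W : lmodType K) (f : A -> W) : Prop :=
  forall c x y, f (c%:P *: x + y) = c *: f x + f y.

Lemma klinD (W : lmodType K) (f : A -> W) : klin f -> add_map f.
Proof. by move=> fL x y; have := fL 1 x y; rewrite !scale1r. Qed.

Lemma klinZ (W : lmodType K) (f : A -> W) : klin f ->
  forall c x, f (c%:P *: x) = c *: f x.
Proof.
by move=> fL c x; have := fL c x 0; rewrite (add_map0 (klinD fL)) !addr0.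
Qed.

Lemma klin_sub (W : lmodType K) (f g : A -> W) : klin f -> klin g ->
  klin (fun x => f x - g x).
Proof. by move=> fL gL c x y; rewrite fL gL scalerBr opprD addrACA. Qed.

Lemma bilin_klin (W : lmodType K) (phi : A -> A -> W) :
  (forall y, klin (phi^~ y)) -> (forall x, klin (phi x)) ->
  bilin (phi : restr A -> restr A -> W).
Proof.
move=> p1 p2; split=> [x x' y|x y y'|c x y|c x y].
- exact: (klinD (p1 y)).
- exact: (klinD (p2 x)).
- exact: (klinZ (p1 y)).
- exact: (klinZ (p2 x)).
Qed.

Lemma pure2_klin1 b : klin (fun a : A => pure2 a b).
Proof.
move=> c x y; apply: etrans (tpureDl _ _ _) _; congr (_ + _); exact: tpureZl.
Qed.

Lemma pure2_klin2 a : klin (fun b : A => pure2 a b).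
Proof.
move=> c x y; apply: etrans (tpureDr _ _ _) _; congr (_ + _); exact: tpureZr.
Qed.

Lemma pure3_klin1 b c : klin (fun a : A => pure3 a b c).
Proof.
move=> k x y; rewrite /pure3 pure2_klin1; apply: etrans (tpureDl _ _ _) _.
congr (_ + _); exact: tpureZl.
Qed.

Lemma pure3_klin2 a c : klin (fun b : A => pure3 a b c).
Proof.
move=> k x y; rewrite /pure3 pure2_klin2; apply: etrans (tpureDl _ _ _) _.
congr (_ + _); exact: tpureZl.
Qed.

Lemma pure3_klin3 a b : klin (fun c : A => pure3 a b c).
Proof.
move=> k x y; apply: etrans (tpureDr _ _ _) _; congr (_ + _); exact: tpureZr.
Qed.

Let idL (U : lmodType K) : linear (@id U). Proof. by []. Qed.

Lemma del2_1_linear : linear (@del2_1 K A).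
Proof. exact: tmap_linear (@delr_linear K A) (@idL _). Qed.

Lemma del2_2_linear : linear (@del2_2 K A).
Proof. exact: tmap_linear (@idL _) (@delr_linear K A). Qed.

Lemma del3_1_linear : linear (@del3_1 K A).
Proof. exact: tmap_linear del2_1_linear (@idL _). Qed.

Lemma del3_2_linear : linear (@del3_2 K A).
Proof. exact: tmap_linear del2_2_linear (@idL _). Qed.

Lemma del3_3_linear : linear (@del3_3 K A).
Proof. exact: tmap_linear (@idL _) (@delr_linear K A). Qed.

Lemma pure3_del1 (a b c : A) : pure3 (del a) b c = del3_1 (pure3 a b c).
Proof. exact/esym/del3_1_pure. Qed.

Lemma pure3_del2 (a b c : A) : pure3 a (del b) c = del3_2 (pure3 a b c).
Proof. exact/esym/del3_2_pure. Qed.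

Lemma pure3_del3 (a b c : A) : pure3 a b (del c) = del3_3 (pure3 a b c).
Proof. exact/esym/del3_3_pure. Qed.

Lemma eq_add_tensor2 (W : zmodType) (F G : tensor2 A -> W) :
  add_map F -> add_map G -> (forall a b, F (pure2 a b) = G (pure2 a b)) ->
  F =1 G.
Proof. exact: eq_add_tensor. Qed.

Lemma eq_add_tensor3 (W : zmodType) (F G : W3 -> W) :
  add_map F -> add_map G ->
  (forall a b c, F (pure3 a b c) = G (pure3 a b c)) -> F =1 G.
Proof.
move=> FD GD FG; apply: eq_add_tensor => // z c.
have pD : add_map (fun z : tensor2 A => z ⊗ (c : restr A)).
  exact: tpure_addl.
move: z; apply: eq_add_tensor2 => [||a b].
- exact: add_map_comp pD FD.
- exact: add_map_comp pD GD.
- exact: FG.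
Qed.

Let d1D := linear_add_map del3_1_linear.
Let d2D := linear_add_map del3_2_linear.
Let d3D := linear_add_map del3_3_linear.

Lemma del3_12 t : del3_1 (del3_2 t) = @del3_2 K A (del3_1 t).
Proof.
move: t; apply: eq_add_tensor3 => [||a b c].
- exact: add_map_comp d2D d1D.
- exact: add_map_comp d1D d2D.
- apply: etrans (congr1 _ (del3_2_pure a b c)) _.
  apply: etrans (del3_1_pure _ _ _) _; apply: esym.
  apply: etrans (congr1 _ (del3_1_pure a b c)) _; exact: del3_2_pure.
Qed.

Lemma del3_13 t : del3_1 (del3_3 t) = @del3_3 K A (del3_1 t).
Proof.
move: t; apply: eq_add_tensor3 => [||a b c].
- exact: add_map_comp d3D d1D.
- exact: add_map_comp d1D d3D.
- apply: etrans (congr1 _ (del3_3_pure a b c)) _.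
  apply: etrans (del3_1_pure _ _ _) _; apply: esym.
  apply: etrans (congr1 _ (del3_1_pure a b c)) _; exact: del3_3_pure.
Qed.

Lemma del3_23 t : del3_2 (del3_3 t) = @del3_3 K A (del3_2 t).
Proof.
move: t; apply: eq_add_tensor3 => [||a b c].
- exact: add_map_comp d3D d2D.
- exact: add_map_comp d2D d3D.
- apply: etrans (congr1 _ (del3_3_pure a b c)) _.
  apply: etrans (del3_2_pure _ _ _) _; apply: esym.
  apply: etrans (congr1 _ (del3_2_pure a b c)) _; exact: del3_3_pure.
Qed.

Definition total3 (t : W3) : W3 := del3_1 t + del3_2 t + del3_3 t.

Lemma total3D : add_map total3.
Proof. exact/add_map_add/d3D/add_map_add/d2D/d1D. Qed.

Definition total3_pred : {pred W3} := fun x => `[< exists t, x = total3 t >].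

Fact total3_zmod_closed : zmod_closed total3_pred.
Proof.
split; first by apply/asboolP; exists 0; rewrite (add_map0 total3D).
move=> _ _ /asboolP[t ->] /asboolP[u ->]; apply/asboolP; exists (t - u).
by rewrite (add_mapB total3D).
Qed.

HB.instance Definition _ :=
  GRing.isZmodClosed.Build W3 total3_pred total3_zmod_closed.

(** Congruence modulo total derivatives is turned into equality in this
    quotient. *)
Definition modtotal : Type := Quotient.quot total3_pred.

HB.instance Definition _ := GRing.Zmodule.on modtotal.

Definition mod_total (t : W3) : modtotal :=
  \pi_(Quotient.quot total3_pred)%qT t.

Lemma mod_totalD : add_map mod_total. Proof. exact: raddfD. Qed.

Lemma mod_total_eq0 t : mod_total t = 0 <-> exists u, t = total3 u.
Proof.
have -> : (mod_total t = 0) <-> (t \in total3_pred).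
  rewrite -[t in X in _ <-> X]subr0 Quotient.idealrBE.
  by rewrite -(add_map0 mod_totalD); split=> /eqP.
by split=> [/asboolP|tP] //; apply/asboolP.
Qed.

Lemma mod_total_total3 t :
  mod_total (del3_1 t) + mod_total (del3_2 t) + mod_total (del3_3 t) = 0.
Proof. by rewrite -!mod_totalD; apply/mod_total_eq0; exists t. Qed.

End TensorDerivations.

Section Quadrilinear.

Variables (K : fieldType) (A : lmodType {poly K}) (W : lmodType K).
Variables (pr : A -> A -> {malg A[nat]}) (prB : conf_bilinear pr).

(** The common shape of the terms of the S-equation; [E] places in the tensor
    cube the product of [p] and [q] and the two other factors. *)
Definition sterm (Phi : W -> W) (E : A -> A -> A -> W) (u w p q : A) : W :=
  psubst Phi (fun z => E z u w) (pr p q).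

Variables (Phi : W -> W) (E : A -> A -> A -> W).
Hypotheses (PhiL : linear Phi) (E1 : forall u w, klin (fun z => E z u w))
  (E2 : forall z w, klin (fun u => E z u w)) (E3 : forall z u, klin (E z u)).

Let PD := linear_add_map PhiL.

Let scaleD (c : K) : add_map (fun w : W => c *: w).
Proof. by move=> x y; rewrite scalerDr. Qed.

Lemma psubst_klin (e : A -> A -> W) P : (forall z, klin (e z)) ->
  klin (fun u => psubst Phi (e^~ u) P).
Proof.
move=> eL c x y.
rewrite (psubst_nat (Psi := Phi) _ P (scaleD c)) => [|w]; last first.
  by rewrite (linear_scale PhiL).
by rewrite -psubst_addl //; apply: eq_psubstr => z /=; rewrite eL.
Qed.

Lemma sterm_klin1 w p q : klin (fun u => sterm Phi E u w p q).
Proof. by apply: (@psubst_klin (fun z u => E z u w)) => z. Qed.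

Lemma sterm_klin2 u p q : klin (fun w => sterm Phi E u w p q).
Proof. by apply: (@psubst_klin (fun z => E z u)) => z; exact: E3. Qed.

Let psubst_scale u w (c : K) P :
  psubst Phi (fun z => E z u w) (mapc (fun x => c%:P *: x) P) =
  c *: psubst Phi (fun z => E z u w) P.
Proof.
rewrite (psubst_mapc (@scaleCD K A c) PD (klinD (E1 u w))).
rewrite (psubst_nat (Psi := Phi) _ P (scaleD c)) => [|x]; last first.
  by rewrite (linear_scale PhiL).
by apply: eq_psubstr => z /=; rewrite (klinZ (E1 u w)).
Qed.

Lemma sterm_klin3 u w q : klin (fun p => sterm Phi E u w p q).
Proof.
move=> c x y; rewrite /sterm (conf_addl prB) (conf_scalel prB).
by rewrite (psubstD PD (klinD (E1 u w))) psubst_scale.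
Qed.

Lemma sterm_klin4 u w p : klin (fun q => sterm Phi E u w p q).
Proof.
move=> c x y; rewrite /sterm (conf_addr prB) (conf_scaler prB).
by rewrite (psubstD PD (klinD (E1 u w))) psubst_scale.
Qed.

(* [D0], [D1], [D2] are the operators on W induced by the derivation of the
   three arguments of [E]. *)
Section Derivations.

Variables D0 D1 D2 : W -> W.
Hypotheses (D0D : add_map D0) (D1D : add_map D1) (D2D : add_map D2).
Hypotheses (ED0 : forall z u w, E (del z) u w = D0 (E z u w))
  (ED1 : forall z u w, E z (del u) w = D1 (E z u w))
  (ED2 : forall z u w, E z u (del w) = D2 (E z u w)).
Hypotheses (PD0 : forall w, D0 (Phi w) = Phi (D0 w))
  (PD1 : forall w, D1 (Phi w) = Phi (D1 w))
  (PD2 : forall w, D2 (Phi w) = Phi (D2 w)).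

Lemma sterm_del1 u w p q : sterm Phi E (del u) w p q = D1 (sterm Phi E u w p q).
Proof.
by rewrite (psubst_nat (Psi := Phi) _ _ D1D) //; apply: eq_psubstr => z /=.
Qed.

Lemma sterm_del2 u w p q : sterm Phi E u (del w) p q = D2 (sterm Phi E u w p q).
Proof.
by rewrite (psubst_nat (Psi := Phi) _ _ D2D) //; apply: eq_psubstr => z /=.
Qed.

Lemma sterm_del3 u w p q :
  sterm Phi E u w (del p) q = - Phi (sterm Phi E u w p q).
Proof. by rewrite /sterm (conf_dell prB) psubst_lamN //; exact/klinD/E1. Qed.

Lemma sterm_del4 u w p q : sterm Phi E u w p (del q) =
  D0 (sterm Phi E u w p q) + Phi (sterm Phi E u w p q).
Proof.
have ED := klinD (E1 u w).
rewrite /sterm (conf_delr prB) (psubstD PD ED) psubst_lam //.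
by rewrite (psubst_delp PD ED D0D).
Qed.

End Derivations.

End Quadrilinear.

Section AbstractSExpression.

Variables (K : fieldType) (A : lmodType {poly K}) (W : lmodType K).
Variables (pr : A -> A -> {malg A[nat]}) (prB : conf_bilinear pr).
Variables (E : A -> A -> A -> W) (d1 d2 d3 : W -> W).
Hypotheses (E1 : forall b c, klin (fun a => E a b c))
  (E2 : forall a c, klin (fun b => E a b c)) (E3 : forall a b, klin (E a b)).
Hypotheses (d1L : linear d1) (d2L : linear d2) (d3L : linear d3).
Hypotheses (Ed1 : forall a b c, E (del a) b c = d1 (E a b c))
  (Ed2 : forall a b c, E a (del b) c = d2 (E a b c))
  (Ed3 : forall a b c, E a b (del c) = d3 (E a b c)).
Hypotheses (d12 : forall t, d1 (d2 t) = d2 (d1 t))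
  (d13 : forall t, d1 (d3 t) = d3 (d1 t))
  (d23 : forall t, d2 (d3 t) = d3 (d2 t)).
Variables (Q : zmodType) (pi : W -> Q) (piD : add_map pi).
Hypothesis pi_total : forall t, pi (d1 t) + pi (d2 t) + pi (d3 t) = 0.

Let D1 := linear_add_map d1L.
Let D2 := linear_add_map d2L.
Let D3 := linear_add_map d3L.

Let d13N t := - d1 t - d3 t.

Let d13NL : linear d13N.
Proof. exact: linear_oppB d1L d3L. Qed.


Let F1 := E.
Let F2 z u w := E u z w.
Let F3 z u w := E u w z.

Let F21 u w : klin (fun z => F2 z u w). Proof. exact: E2. Qed.
Let F22 z w : klin (fun u => F2 z u w). Proof. exact: E1. Qed.
Let F23 z u : klin (F2 z u). Proof. exact: E3. Qed.
Let F31 u w : klin (fun z => F3 z u w). Proof. exact: E3. Qed.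
Let F32 z w : klin (fun u => F3 z u w). Proof. exact: E1. Qed.
Let F33 z u : klin (F3 z u). Proof. exact: E2. Qed.

(** The contribution to the S-equation of two terms [x1 (x) x2] and [y1 (x) y2] of
    [r]. The commutator of the third term is expanded: substituting d1 in its
    reflected half amounts to substituting - d1 - d3 in the product. *)
Definition spair (x1 x2 y1 y2 : A) : W :=
  sterm pr d2 F1 y1 x2 y2 x1 - sterm pr d1 F2 y1 x2 y2 x1 -
  (sterm pr d1 F3 x1 y1 x2 y2 - sterm pr d13N F3 x1 y1 y2 x2).

Lemma sterm_commutator x1 x2 y1 y2 :
  psubst d1 (E x1 y1) (commutator pr x2 y2) =
  sterm pr d1 F3 x1 y1 x2 y2 - sterm pr d13N F3 x1 y1 y2 x2.
Proof.
have ED := klinD (E3 x1 y1).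
by rewrite /commutator (add_mapB (psubstD D1 ED)) (psubst_refl D1 ED D3).
Qed.

Lemma spair_bilin1 y1 y2 :
  bilin ((fun x1 x2 => spair x1 x2 y1 y2) : restr A -> restr A -> W).
Proof.
apply: bilin_klin => [x2|x1]; apply: klin_sub; apply: klin_sub.
- exact: sterm_klin4.
- exact: sterm_klin4.
- exact: sterm_klin1.
- exact: sterm_klin1.
- exact: sterm_klin2.
- exact: sterm_klin2.
- exact: sterm_klin3.
- exact: sterm_klin4.
Qed.

Lemma spair_bilin2 x1 x2 : bilin (spair x1 x2 : restr A -> restr A -> W).
Proof.
apply: bilin_klin => [y2|y1]; apply: klin_sub; apply: klin_sub.
- exact: sterm_klin1.
- exact: sterm_klin1.
- exact: sterm_klin2.
- exact: sterm_klin2.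
- exact: sterm_klin3.
- exact: sterm_klin3.
- exact: sterm_klin4.
- exact: sterm_klin3.
Qed.

Let d21 t : d2 (d1 t) = d1 (d2 t). Proof. by rewrite d12. Qed.
Let d31 t : d3 (d1 t) = d1 (d3 t). Proof. by rewrite d13. Qed.
Let d32 t : d3 (d2 t) = d2 (d3 t). Proof. by rewrite d23. Qed.

Let d1N1 w : d1 (d13N w) = d13N (d1 w).
Proof. by rewrite /d13N (add_mapB D1) (add_mapN D1) d13. Qed.

Let d2N w : d2 (d13N w) = d13N (d2 w).
Proof. by rewrite /d13N (add_mapB D2) (add_mapN D2) d12 d23. Qed.

Let d3N w : d3 (d13N w) = d13N (d3 w).
Proof. by rewrite /d13N (add_mapB D3) (add_mapN D3) d13. Qed.

Let F2d0 z u w : F2 (del z) u w = d2 (F2 z u w). Proof. exact: Ed2. Qed.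
Let F2d1 z u w : F2 z (del u) w = d1 (F2 z u w). Proof. exact: Ed1. Qed.
Let F2d2 z u w : F2 z u (del w) = d3 (F2 z u w). Proof. exact: Ed3. Qed.
Let F3d0 z u w : F3 (del z) u w = d3 (F3 z u w). Proof. exact: Ed3. Qed.
Let F3d1 z u w : F3 z (del u) w = d1 (F3 z u w). Proof. exact: Ed1. Qed.
Let F3d2 z u w : F3 z u (del w) = d2 (F3 z u w). Proof. exact: Ed2. Qed.

Let pi_total' t : pi (d1 t + d2 t + d3 t) = 0.
Proof. by rewrite !piD. Qed.

(** A total derivative in one of the two copies of [r] makes each of the four
    terms zero or a total derivative, by conformal sesquilinearity: in every
    product, the variable becomes the derivation of the slot of the factor that
    accompanies the left operand in [r]. *)
Lemma spair_total1 x1 x2 y1 y2 :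
  pi (spair (del x1) x2 y1 y2 + spair x1 (del x2) y1 y2) = 0.
Proof.
rewrite /spair (addrACA _ (- _)) -opprD (addrACA (sterm _ _ _ _ _ _ _) (- _)).
rewrite -opprD (addrACA (sterm _ _ _ _ _ _ _) (- _)) -opprD !(add_mapB piD).
have -> : sterm pr d2 F1 y1 x2 y2 (del x1) =
    d1 (sterm pr d2 F1 y1 x2 y2 x1) + d2 (sterm pr d2 F1 y1 x2 y2 x1).
  by rewrite (sterm_del4 prB d2L _ D1).
have -> : sterm pr d2 F1 y1 (del x2) y2 x1 = d3 (sterm pr d2 F1 y1 x2 y2 x1).
  by apply: sterm_del2.
have -> : sterm pr d1 F2 y1 x2 y2 (del x1) =
    d1 (sterm pr d1 F2 y1 x2 y2 x1) + d2 (sterm pr d1 F2 y1 x2 y2 x1).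
  by rewrite addrC (sterm_del4 prB d1L _ D2).
have -> : sterm pr d1 F2 y1 (del x2) y2 x1 = d3 (sterm pr d1 F2 y1 x2 y2 x1).
  by apply: sterm_del2.
have -> : sterm pr d1 F3 (del x1) y1 x2 y2 = d1 (sterm pr d1 F3 x1 y1 x2 y2).
  by apply: sterm_del1.
have -> : sterm pr d1 F3 x1 y1 (del x2) y2 = - d1 (sterm pr d1 F3 x1 y1 x2 y2).
  by apply: sterm_del3.
have -> : sterm pr d13N F3 (del x1) y1 y2 x2 =
    d1 (sterm pr d13N F3 x1 y1 y2 x2).
  by apply: sterm_del1.
have -> : sterm pr d13N F3 x1 y1 y2 (del x2) =
    d3 (sterm pr d13N F3 x1 y1 y2 x2) + d13N (sterm pr d13N F3 x1 y1 y2 x2).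
  by rewrite (sterm_del4 prB d13NL _ D3).
have Z0 t : d1 t + (d3 t + d13N t) = 0 by rewrite /d13N addrA -opprD subrr.
by rewrite !pi_total' Z0 !subrr.
Qed.

Lemma spair_total2 x1 x2 y1 y2 :
  pi (spair x1 x2 (del y1) y2 + spair x1 x2 y1 (del y2)) = 0.
Proof.
rewrite /spair (addrACA _ (- _)) -opprD (addrACA (sterm _ _ _ _ _ _ _) (- _)).
rewrite -opprD (addrACA (sterm _ _ _ _ _ _ _) (- _)) -opprD !(add_mapB piD).
have -> : sterm pr d2 F1 (del y1) x2 y2 x1 = d2 (sterm pr d2 F1 y1 x2 y2 x1).
  by apply: sterm_del1.
have -> : sterm pr d2 F1 y1 x2 (del y2) x1 = - d2 (sterm pr d2 F1 y1 x2 y2 x1).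
  by apply: sterm_del3.
have -> : sterm pr d1 F2 (del y1) x2 y2 x1 = d1 (sterm pr d1 F2 y1 x2 y2 x1).
  by apply: sterm_del1.
have -> : sterm pr d1 F2 y1 x2 (del y2) x1 = - d1 (sterm pr d1 F2 y1 x2 y2 x1).
  by apply: sterm_del3.
have -> : sterm pr d1 F3 x1 (del y1) x2 y2 = d2 (sterm pr d1 F3 x1 y1 x2 y2).
  by apply: sterm_del2.
have -> : sterm pr d1 F3 x1 y1 x2 (del y2) =
    d3 (sterm pr d1 F3 x1 y1 x2 y2) + d1 (sterm pr d1 F3 x1 y1 x2 y2).
  by rewrite (sterm_del4 prB d1L _ D3).
have -> : sterm pr d13N F3 x1 (del y1) y2 x2 =
    d2 (sterm pr d13N F3 x1 y1 y2 x2).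
  by apply: sterm_del2.
have -> : sterm pr d13N F3 x1 y1 (del y2) x2 =
    - d13N (sterm pr d13N F3 x1 y1 y2 x2).
  by apply: sterm_del3.
have Y0 t : d2 t + (d3 t + d1 t) = d1 t + d2 t + d3 t.
  by rewrite [d3 t + _]addrC addrCA addrA.
have Z0 t : d2 t - d13N t = d1 t + d2 t + d3 t.
  by rewrite /d13N opprB opprK Y0.
by rewrite Y0 Z0 !pi_total' !subrr.
Qed.

(** Modulo total derivatives, - d1 - d3 is d2. *)
Lemma pi_psubst_d13N (e : A -> W) p :
  pi (psubst d13N e p) = pi (psubst d2 e p).
Proof.
rewrite /psubst !(add_map_sum piD); apply: eq_bigr => n _.
apply: iter_agree => // w; rewrite -[RHS]subr0 -(pi_total' w) -(add_mapB piD).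
by congr pi; rewrite /d13N [d1 _ + d2 _]addrC -addrA [in RHS]opprD addNKr opprD.
Qed.

End AbstractSExpression.

Section SExpressionModulo.

Variables (K : fieldType) (A : lmodType {poly K}).
Variables (pr : A -> A -> {malg A[nat]}) (prB : conf_bilinear pr).

Definition spair3 : A -> A -> A -> A -> tensor3 A :=
  spair pr (@pure3 K A) (@del3_1 K A) (@del3_2 K A) (@del3_3 K A).

Lemma S_exprE s :
  S_expr pr s = \sum_(i <- s) \sum_(j <- s) spair3 i.1 i.2 j.1 j.2.
Proof.
rewrite /S_expr -!sumrB; apply: eq_bigr => i _; rewrite -!sumrB.
apply: eq_bigr => j _; congr (_ - _ - _).
exact: (sterm_commutator pr (@pure3_klin3 K A) (@del3_1_linear K A)
  (@del3_3_linear K A) (@pure3_del3 K A) (@del3_13 K A)).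
Qed.

Let bilin1 y1 y2 :
  bilin ((fun x1 x2 => spair3 x1 x2 y1 y2) : restr A -> restr A -> tensor3 A).
Proof.
exact: (spair_bilin1 prB
  (@pure3_klin1 K A) (@pure3_klin2 K A) (@pure3_klin3 K A)
  (@del3_1_linear K A) (@del3_2_linear K A) (@del3_3_linear K A)).
Qed.

Let bilin2 x1 x2 : bilin (spair3 x1 x2 : restr A -> restr A -> tensor3 A).
Proof.
exact: (spair_bilin2 prB
  (@pure3_klin1 K A) (@pure3_klin2 K A) (@pure3_klin3 K A)
  (@del3_1_linear K A) (@del3_2_linear K A) (@del3_3_linear K A)).
Qed.

Let total1 x1 x2 y1 y2 :
  mod_total (spair3 (del x1) x2 y1 y2 + spair3 x1 (del x2) y1 y2) = 0.
Proof.
apply: (spair_total1 prB (@pure3_klin1 K A) (@pure3_klin2 K A)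
  (@pure3_klin3 K A) (@del3_1_linear K A) (@del3_2_linear K A)
  (@del3_3_linear K A) (@pure3_del1 K A) (@pure3_del2 K A)
  (@pure3_del3 K A) (@del3_12 K A) (@del3_13 K A) (@del3_23 K A)
  (@mod_totalD K A) (@mod_total_total3 K A)).
Qed.

Let total2 x1 x2 y1 y2 :
  mod_total (spair3 x1 x2 (del y1) y2 + spair3 x1 x2 y1 (del y2)) = 0.
Proof.
apply: (spair_total2 prB (@pure3_klin1 K A) (@pure3_klin2 K A)
  (@pure3_klin3 K A) (@del3_1_linear K A) (@del3_2_linear K A)
  (@del3_3_linear K A) (@pure3_del1 K A) (@pure3_del2 K A)
  (@pure3_del3 K A) (@del3_12 K A) (@del3_13 K A) (@del3_23 K A)
  (@mod_totalD K A) (@mod_total_total3 K A)).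
Qed.

Definition spair_sum (s s' : seq (A * A)) : tensor3 A :=
  \sum_(i <- s) \sum_(j <- s') spair3 i.1 i.2 j.1 j.2.

Definition pure2_sum (s : seq (A * A)) : tensor2 A :=
  \sum_(x <- s) pure2 x.1 x.2.

Let spair_suml s1 s2 s' :
  pure2_sum s1 = pure2_sum s2 -> spair_sum s1 s' = spair_sum s2 s'.
Proof.
move=> s12; rewrite /spair_sum exchange_big [RHS]exchange_big /=.
apply: eq_bigr => j _; exact: tensor_sum_ext (bilin1 j.1 j.2) s12.
Qed.

Let spair_sumr s s1 s2 :
  pure2_sum s1 = pure2_sum s2 -> spair_sum s s1 = spair_sum s s2.
Proof.
move=> s12; rewrite /spair_sum.
apply: eq_bigr => i _; exact: tensor_sum_ext (bilin2 i.1 i.2) s12.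
Qed.

(** The derivation of a tensor, on lists of pure tensors. *)
Definition dseq (s : seq (A * A)) : seq (A * A) :=
  [seq (del x.1, x.2) | x <- s] ++ [seq (x.1, del x.2) | x <- s].

Let pure2_dseq s :
  pure2_sum (dseq s) = del2_1 (pure2_sum s) + del2_2 (pure2_sum s).
Proof.
rewrite /pure2_sum /dseq big_cat !big_map /=.
rewrite (add_map_sum (linear_add_map (@del2_1_linear K A))).
rewrite (add_map_sum (linear_add_map (@del2_2_linear K A))).
by congr (_ + _); apply: eq_bigr => x _; rewrite (del2_1_pure, del2_2_pure).
Qed.

Let mod_total_dseql s s' : mod_total (spair_sum (dseq s) s') = 0.
Proof.
rewrite /spair_sum /dseq big_cat !big_map /= -big_split /=.
rewrite (add_map_sum (@mod_totalD K A)) big1 // => x _.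
rewrite -big_split /= (add_map_sum (@mod_totalD K A)).
by rewrite big1 // => y _; exact: total1.
Qed.

Let mod_total_dseqr s s' : mod_total (spair_sum s (dseq s')) = 0.
Proof.
rewrite /spair_sum (add_map_sum (@mod_totalD K A)) big1 // => x _.
rewrite /dseq big_cat !big_map /= -big_split /=.
by rewrite (add_map_sum (@mod_totalD K A)) big1 // => y _; exact: total2.
Qed.

(** The left-hand side of the S-equation is bilinear in [r], and vanishes modulo
    total derivatives when one copy of [r] is a total derivative. *)
Lemma S_expr_modulo s s0 t :
  pure2_sum s = pure2_sum s0 + (del2_1 t + del2_2 t) ->
  mod_total (S_expr pr s) = mod_total (S_expr pr s0).
Proof.
have [tl tE] := tensor_span t; rewrite -/(pure2_sum tl) in tE.
rewrite tE -pure2_dseq => sE.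
have {}sE : pure2_sum s = pure2_sum (s0 ++ dseq tl).
  by apply: etrans sE _; apply/esym/big_cat.
rewrite !S_exprE -/(spair_sum s s) -/(spair_sum s0 s0).
rewrite (spair_suml _ sE) (spair_sumr _ sE) {1}/spair_sum big_cat /=.
rewrite mod_totalD [X in _ + X]mod_total_dseql addr0.
have -> : \sum_(i <- s0) \sum_(j <- s0 ++ dseq tl) spair3 i.1 i.2 j.1 j.2 =
    spair_sum s0 s0 + spair_sum s0 (dseq tl).
  by rewrite -big_split; apply: eq_bigr => i _; rewrite big_cat.
by rewrite mod_totalD mod_total_dseqr addr0.
Qed.

End SExpressionModulo.

(** * The canonical invariant of a representation and its dual *)

Section InvariantPairing.

Variables (K : fieldType) (R V : lmodType {poly K}).
Variables (rho : R -> V -> {malg V[nat]}).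
Variables (rhos : R -> cdual V -> {malg (cdual V)[nat]}).
Hypothesis rhosE : is_dual_representation rho rhos.
Variables (m : nat) (v : 'I_m -> V) (vs : 'I_m -> cdual V).
Hypotheses (vB : is_basis v) (vsv : forall i k, vs i (v k) = (i == k)%:R).

Variables (W : lmodType K) (L D1 D2 : W -> W) (b : V -> cdual V -> W).
Hypotheses (LD : add_map L) (D1D : add_map D1) (D2D : add_map D2).
Hypotheses (LD1 : forall x, L (D1 x) = D1 (L x))
  (LD2 : forall x, L (D2 x) = D2 (L x)) (D12 : forall x, D1 (D2 x) = D2 (D1 x)).
Hypotheses (b1 : forall f, klin (b^~ f)) (b2 : forall u, klin (b u)).
Hypotheses (bD1 : forall u f, b (del u) f = D1 (b u f))
  (bD2 : forall u f, b u (del f) = D2 (b u f)).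
Variables (Q : zmodType) (pi : W -> Q) (piD : add_map pi).
Hypothesis pi_total : forall x, pi (L x) + pi (D1 x) + pi (D2 x) = 0.

Let scD (w : W) : add_map (fun c : K => c *: w).
Proof. by move=> c d; rewrite scalerDl. Qed.

Let b_scale1 p u f : b (p *: u) f = psum D1 (fun c => c *: b u f) p.
Proof.
move: p; apply: psum_unique => // [p q|c|q].
- by rewrite scalerDl (klinD (b1 f)).
- exact: (klinZ (b1 f)).
- by rewrite mulrC -scalerA bD1.
Qed.

Let b_scale2 p u f :
  b u ((p \Po - 'X) *: f) = psum (fun x => - D2 x) (fun c => c *: b u f) p.
Proof.
have ND : add_map (fun x => - D2 x) := add_map_opp D2D.
move: p; apply: psum_unique => // [p q|c|q].
- by rewrite comp_polyD scalerDl (klinD (b2 u)).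
- by rewrite comp_polyC (klinZ (b2 u)).
- rewrite comp_polyM comp_polyX mulrC mulNr scaleNr (add_mapN (klinD (b2 u))).
  by rewrite -scalerA bD2.
Qed.

Let pi_psubst (M : lmodType {poly K}) (emb : K -> W) (h : M -> {poly K}) p :
  pi (psubst L (fun w => psum (fun x => - D2 x - L x) emb (h w)) p) =
  pi (psubst L (fun w => psum D1 emb (h w)) p).
Proof.
pose N x := - D2 x - L x.
have ND : add_map N := add_map_sub (add_map_opp D2D) LD.
have NC x : N (L x) = L (N x).
  by rewrite /N (add_mapB LD) (add_mapN LD) LD2.
have ND1 x : D1 (N x) = N (D1 x).
  by rewrite /N (add_mapB D1D) (add_mapN D1D) LD1 D12.
rewrite /psubst !(add_map_sum piD); apply: eq_bigr => n _.
have LnD := add_map_iter n LD; rewrite /psum !(add_map_sum LnD, add_map_sum piD).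
apply: eq_bigr => l _; rewrite -/N.
have LnN x : iter n L (N x) = N (iter n L x) by apply/esym/iter_swap.
have LnD1 x : iter n L (D1 x) = D1 (iter n L x).
  by apply/esym/iter_swap => y; rewrite LD1.
rewrite (iter_swap l LnN) (iter_swap l LnD1); apply: iter_agree => // x.
rewrite /N (add_mapB piD) (add_mapN piD) -[LHS]addr0 -(pi_total x).
by rewrite -[pi (L x) + _ + _]addrA [LHS]addrA subrK addrC addrK.
Qed.

(** The canonical element [sum_i v_i (x) v_i^*] of V (x) V^* is invariant modulo
    total derivatives; [b] is the image of V (x) V^* in W, and [L] the operator
    substituted for the variable of the action. Both sums are expanded in the
    dual bases; the matrix of [rhos] is minus the transpose of that of [rho],
    with mu - lambda for d, that is, with - D2 - L, which is D1 modulo total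
    derivatives. *)
Lemma invariant_pairing a :
  \sum_i pi (psubst L (b (v i)) (rhos a (vs i))) +
  \sum_i pi (psubst L (b^~ (vs i)) (rho a (v i))) = 0.
Proof.
have expand i : psubst L (b (v i)) (rhos a (vs i)) =
    \sum_k psubst L (fun g : cdual V => psum (fun x => - D2 x)
      (fun c => c *: b (v i) (vs k)) (g (v k))) (rhos a (vs i)).
  rewrite -psubst_suml //; apply: eq_psubstr => g.
  rewrite {1}[g](dual_basis_expansion vB vsv) (add_map_sum (klinD (b2 (v i)))).
  by apply: eq_bigr => k _; rewrite b_scale2.
have contract k : psubst L (b^~ (vs k)) (rho a (v k)) =
    \sum_i psubst L (fun w : V => psum D1
      (fun c => c *: b (v i) (vs k)) (vs i w)) (rho a (v k)).
  rewrite -psubst_suml //; apply: eq_psubstr => w.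
  rewrite {1}[w](dual_basis_coord vB vsv) (add_map_sum (klinD (b1 (vs k)))).
  by apply: eq_bigr => i _; rewrite b_scale1.
under eq_bigr => i _ do rewrite expand (add_map_sum piD).
under [X in _ + X]eq_bigr => i _ do rewrite contract (add_map_sum piD).
rewrite [X in _ + X]exchange_big -big_split /= big1 // => i _.
rewrite -big_split /= big1 // => k _.
rewrite (dual_rep_op rhosE) //; first last.
- by move=> x; rewrite (add_mapN LD) LD2.
- exact: add_map_opp.
by rewrite (add_mapN piD) pi_psubst addNr.
Qed.

End InvariantPairing.

(** * The symmetric solution built from dual bases *)

Section CanonicalSolution.

Variables (K : fieldType) (R V : lmodType {poly K}).
Variables (rho : R -> V -> {malg V[nat]}).
Variables (rhos : R -> cdual V -> {malg (cdual V)[nat]}).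
Hypothesis rhosE : is_dual_representation rho rhos.
Variables (m : nat) (v : 'I_m -> V) (vs : 'I_m -> cdual V).
Hypotheses (vB : is_basis v) (vsv : forall i k, vs i (v k) = (i == k)%:R).

Variables (A : lmodType {poly K}) (pr : A -> A -> {malg A[nat]}) (T : V -> R).
Variables (inV : {linear V -> A}) (inD : {linear cdual V -> A}).
Hypotheses (prVV : forall u w, pr (inV u) (inV w) = mapc inV (rho (T u) w))
  (prVD : forall u g, pr (inV u) (inD g) = mapc inD (rhos (T u) g))
  (prD : forall g x, pr (inD g) x = 0).

Variables (W : lmodType K) (E : A -> A -> A -> W) (d1 d2 d3 : W -> W).
Hypotheses (E1 : forall b c, klin (fun a => E a b c))
  (E2 : forall a c, klin (fun b => E a b c)) (E3 : forall a b, klin (E a b)).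
Hypotheses (d1L : linear d1) (d2L : linear d2) (d3L : linear d3).
Hypotheses (Ed1 : forall a b c, E (del a) b c = d1 (E a b c))
  (Ed2 : forall a b c, E a (del b) c = d2 (E a b c))
  (Ed3 : forall a b c, E a b (del c) = d3 (E a b c)).
Hypotheses (d12 : forall t, d1 (d2 t) = d2 (d1 t))
  (d13 : forall t, d1 (d3 t) = d3 (d1 t))
  (d23 : forall t, d2 (d3 t) = d3 (d2 t)).
Variables (Q : zmodType) (pi : W -> Q) (piD : add_map pi).
Hypothesis pi_total : forall t, pi (d1 t) + pi (d2 t) + pi (d3 t) = 0.

Let D1 := linear_add_map d1L.
Let D2 := linear_add_map d2L.
Let D3 := linear_add_map d3L.

Local Notation av i := (inV (v i)).
Local Notation fv i := (inD (vs i)).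

Let klin_in (M : lmodType {poly K}) (f : {linear M -> A}) (e : A -> W) :
  klin e -> klin (e \o f).
Proof. by move=> eL c x y /=; rewrite linearP eL. Qed.

Let onV (L : W -> W) (e : A -> W) u w : add_map L -> klin e ->
  psubst L e (pr (inV u) (inV w)) = psubst L (fun x => e (inV x)) (rho (T u) w).
Proof.
by move=> LD eL; rewrite prVV (psubst_mapc (raddf_add_map inV) LD (klinD eL)).
Qed.

Let onD (L : W -> W) (e : A -> W) u g : add_map L -> klin e ->
  psubst L e (pr (inV u) (inD g)) = psubst L (fun x => e (inD x)) (rhos (T u) g).
Proof.
by move=> LD eL; rewrite prVD (psubst_mapc (raddf_add_map inD) LD (klinD eL)).
Qed.

Let on0 (L : W -> W) (e : A -> W) g x : psubst L e (pr (inD g) x) = 0.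
Proof. by rewrite prD /psubst msupp0 big_nil. Qed.

Local Notation spair' := (spair pr E d1 d2 d3).

Let pi_spair x1 x2 y1 y2 : pi (spair' x1 x2 y1 y2) =
  pi (psubst d2 (fun z => E z y1 x2) (pr y2 x1)) -
  pi (psubst d1 (fun z => E y1 z x2) (pr y2 x1)) -
  pi (psubst d1 (E x1 y1) (pr x2 y2)) +
  pi (psubst d2 (E x1 y1) (pr y2 x2)).
Proof.
rewrite /spair !(add_mapB piD) opprB [X in _ + X]addrC addrA.
by congr (_ + _); exact: (pi_psubst_d13N d2L d12 d23 piD pi_total).
Qed.

(** The contributions in which the product lies in V, resp. in V^*, for a
   placement [b] of the three factors. *)
Let X (L : W -> W) (b : 'I_m -> V -> cdual V -> W) i j :=
  pi (psubst L (fun w => b j w (vs i)) (rho (T (v j)) (v i))).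
Let Y (L : W -> W) (b : 'I_m -> V -> cdual V -> W) i j :=
  pi (psubst L (fun g => b j (v i) g) (rhos (T (v j)) (vs i))).

Let b1 j w g := E (inV w) (fv j) (inD g).
Let b2 j w g := E (fv j) (inV w) (inD g).
Let b3 j w g := E (inD g) (fv j) (inV w).
Let b4 j w g := E (fv j) (inD g) (inV w).

Let XY_cancel (L : W -> W) (b : 'I_m -> V -> cdual V -> W) :
  (forall j, \sum_i Y L b i j + \sum_i X L b i j = 0) ->
  \sum_i \sum_j (Y L b i j + X L b i j) = 0.
Proof.
move=> XY0; rewrite exchange_big big1 // => j _.
by rewrite big_split; exact: XY0.
Qed.

Let cancel1 : \sum_i \sum_j (Y d2 b1 i j + X d2 b1 i j) = 0.
Proof.
apply: XY_cancel => j.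
apply: (invariant_pairing rhosE vB vsv (L := d2) (D1 := d1) (D2 := d3)) => //.
- by move=> f; exact: (klin_in inV (E1 _ _)).
- by move=> u; exact: (klin_in inD (E3 _ _)).
- by move=> u f; rewrite /b1 linear_del Ed1.
- by move=> u f; rewrite /b1 linear_del Ed3.
- by move=> x; rewrite [pi (d2 x) + _]addrC.
Qed.

Let cancel2 : \sum_i \sum_j (Y d1 b2 i j + X d1 b2 i j) = 0.
Proof.
apply: XY_cancel => j.
apply: (invariant_pairing rhosE vB vsv (L := d1) (D1 := d2) (D2 := d3)) => //.
- by move=> f; exact: (klin_in inV (E2 _ _)).
- by move=> u; exact: (klin_in inD (E3 _ _)).
- by move=> u f; rewrite /b2 linear_del Ed2.
- by move=> u f; rewrite /b2 linear_del Ed3.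
Qed.

Let cancel3 : \sum_i \sum_j (Y d2 b3 i j + X d2 b3 i j) = 0.
Proof.
apply: XY_cancel => j.
apply: (invariant_pairing rhosE vB vsv (L := d2) (D1 := d3) (D2 := d1)) => //.
- by move=> f; exact: (klin_in inV (E3 _ _)).
- by move=> u; exact: (klin_in inD (E1 _ _)).
- by move=> u f; rewrite /b3 linear_del Ed3.
- by move=> u f; rewrite /b3 linear_del Ed1.
- by move=> x; rewrite addrC addrA.
Qed.

Let cancel4 : \sum_i \sum_j (Y d1 b4 i j + X d1 b4 i j) = 0.
Proof.
apply: XY_cancel => j.
apply: (invariant_pairing rhosE vB vsv (L := d1) (D1 := d3) (D2 := d2)) => //.
- by move=> f; exact: (klin_in inV (E3 _ _)).
- by move=> u; exact: (klin_in inD (E2 _ _)).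
- by move=> u f; rewrite /b4 linear_del Ed3.
- by move=> u f; rewrite /b4 linear_del Ed2.
- by move=> x; rewrite addrAC.
Qed.

(** The tensor sum_i (v_i (x) v_i^* + v_i^* (x) v_i), V and its dual being embedded
    in A. *)
Definition canonical_seq : seq (A * A) :=
  [seq (av i, fv i) | i <- index_enum 'I_m] ++
  [seq (fv i, av i) | i <- index_enum 'I_m].

(** A product that survives has its left factor in V, and there are four
    placements of its value: for each of them the contributions of V and of V^*
    cancel by [invariant_pairing]. *)
Lemma canonical_solution :
  \sum_(x <- canonical_seq) \sum_(y <- canonical_seq)
    pi (spair' x.1 x.2 y.1 y.2) = 0.
Proof.
have swapX L b : \sum_i \sum_j X L b i j = \sum_i \sum_j X L b j i.
  by rewrite exchange_big.
have swapY L b : \sum_i \sum_j Y L b i j = \sum_i \sum_j Y L b j i.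
  by rewrite exchange_big.
have aa i j : pi (spair' (av i) (fv i) (av j) (fv j)) = 0.
  by rewrite pi_spair !on0 (add_map0 piD) !subrr addr0.
have af i j : pi (spair' (av i) (fv i) (fv j) (av j)) =
    X d2 b1 i j + Y d2 b1 i j - X d1 b2 i j.
  rewrite pi_spair on0 (add_map0 piD) subr0 !onV // onD //.
  by rewrite addrAC.
have fa i j : pi (spair' (fv i) (av i) (av j) (fv j)) = - Y d1 b2 j i.
  by rewrite pi_spair !on0 (add_map0 piD) subrr sub0r addr0 onD.
have ff i j : pi (spair' (fv i) (av i) (fv j) (av j)) =
    Y d2 b3 i j + X d2 b3 i j - (Y d1 b4 i j + X d1 b4 j i).
  rewrite pi_spair !onD // !onV //.
  have regroup (p q r s : Q) : p - q - r + s = p + s - (q + r).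
    by rewrite addrAC [p - q + s]addrAC opprD addrA.
  exact: regroup.
rewrite /canonical_seq big_cat !big_map /= -big_split /=.
transitivity (\sum_i \sum_j
   ((Y d2 b1 i j + X d2 b1 i j) - (Y d1 b2 j i + X d1 b2 i j) +
    ((Y d2 b3 i j + X d2 b3 i j) - (Y d1 b4 i j + X d1 b4 j i)))).
  apply: eq_bigr => i _; rewrite !big_cat !big_map /= -!big_split /=.
  apply: eq_bigr => j _; rewrite aa af fa ff add0r addrA; congr (_ + _).
  by rewrite opprD addrA addrAC [Y _ _ _ _ + _]addrC.
have split2 (F G : 'I_m -> 'I_m -> Q) :
    \sum_i \sum_j (F i j + G i j) = \sum_i \sum_j F i j + \sum_i \sum_j G i j.
  by rewrite -big_split; apply: eq_bigr => i _; rewrite big_split.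
have split2N (F G : 'I_m -> 'I_m -> Q) :
    \sum_i \sum_j (F i j - G i j) = \sum_i \sum_j F i j - \sum_i \sum_j G i j.
  by rewrite -sumrB; apply: eq_bigr => i _; rewrite sumrB.
rewrite (split2 (fun i j => _ - _) (fun i j => _ - _)) !split2N cancel1 cancel3.
rewrite (split2 (fun i j => Y d1 b2 j i) (X d1 b2)) -swapY -split2 cancel2.
rewrite (split2 (Y d1 b4) (fun i j => X d1 b4 j i)) -swapX -split2 cancel4.
by rewrite !subrr addr0.
Qed.

End CanonicalSolution.

Section CanonicalSExpression.

Variables (K : fieldType) (R V : lmodType {poly K}).
Variables (rho : R -> V -> {malg V[nat]}).
Variables (rhos : R -> cdual V -> {malg (cdual V)[nat]}).
Hypothesis rhosE : is_dual_representation rho rhos.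
Variables (m : nat) (v : 'I_m -> V) (vs : 'I_m -> cdual V).
Hypotheses (vB : is_basis v) (vsv : forall i k, vs i (v k) = (i == k)%:R).
Variables (A : lmodType {poly K}) (pr : A -> A -> {malg A[nat]}) (T : V -> R).
Hypothesis prB : conf_bilinear pr.
Variables (inV : {linear V -> A}) (inD : {linear cdual V -> A}).
Hypotheses (prVV : forall u w, pr (inV u) (inV w) = mapc inV (rho (T u) w))
  (prVD : forall u g, pr (inV u) (inD g) = mapc inD (rhos (T u) g))
  (prD : forall g x, pr (inD g) x = 0).

Let s0 := canonical_seq v vs inV inD.

Lemma canonical_S_expr : mod_total (S_expr pr s0) = 0.
Proof.
rewrite (S_exprE pr) (add_map_sum (@mod_totalD K A)).
transitivity (\sum_(x <- s0) \sum_(y <- s0)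
    mod_total (spair3 pr x.1 x.2 y.1 y.2)).
  by apply: eq_bigr => x _; exact: (add_map_sum (@mod_totalD K A)).
exact: (canonical_solution rhosE vB vsv prVV prVD prD
  (@pure3_klin1 K A) (@pure3_klin2 K A) (@pure3_klin3 K A)
  (@del3_1_linear K A) (@del3_2_linear K A) (@del3_3_linear K A)
  (@pure3_del1 K A) (@pure3_del2 K A) (@pure3_del3 K A)
  (@del3_12 K A) (@del3_13 K A) (@del3_23 K A)
  (@mod_totalD K A) (@mod_total_total3 K A)).
Qed.

Lemma canonical_solves (t : tensor2 A) (r : tensor2 A) :
  r = \sum_i (pure2 (inV (v i)) (inD (vs i)) + pure2 (inD (vs i)) (inV (v i))) +
      (del2_1 t + del2_2 t) ->
  solves_S_equation pr r.
Proof.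
move=> rE s sE; apply/mod_total_eq0; rewrite -canonical_S_expr.
apply: (S_expr_modulo prB (t := t)).
apply: etrans (esym sE) _; rewrite rE; congr (_ + _).
by rewrite /pure2_sum /s0 /canonical_seq big_cat !big_map big_split.
Qed.

End CanonicalSExpression.

(** * The tensor attached to a family of generalized polynomials *)

Section LambdaModule.

Variables (K : fieldType) (M : lmodType {poly K}).

(** M[lambda] as a vector space over [K], to be the target of linear maps defined
    on tensor products. *)
Definition lampoly : Type := {malg M[nat]}.

HB.instance Definition _ := GRing.Zmodule.on lampoly.

Definition lampoly_scale (c : K) (p : lampoly) : lampoly :=
  mapc (fun x : M => c%:P *: x) (p : {malg M[nat]}).

Let coef_scale (c : K) (p : {malg M[nat]}) k :
  (mapc (fun x : M => c%:P *: x) p)@_k = c%:P *: p@_k.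
Proof. by rewrite (mcoeffc _ _ (@scaleCD K M c)). Qed.

Fact lampoly_scaleA a b p :
  lampoly_scale a (lampoly_scale b p) = lampoly_scale (a * b) p.
Proof.
by apply/malgP => k; rewrite !coef_scale scalerA polyCM.
Qed.

Fact lampoly_scale1 : left_id 1 lampoly_scale.
Proof. by move=> p; apply/malgP => k; rewrite coef_scale scale1r. Qed.

Fact lampoly_scaleDr : right_distributive lampoly_scale +%R.
Proof. by move=> a p q; exact: (mapcD (@scaleCD K M a)). Qed.

Fact lampoly_scaleDl p : {morph lampoly_scale^~ p : a b / a + b}.
Proof.
move=> a b; apply/malgP => k.
by rewrite mcoeffD !coef_scale polyCD scalerDl.
Qed.

HB.instance Definition _ := GRing.Zmodule_isLmodule.Build K lampoly
  lampoly_scaleA lampoly_scale1 lampoly_scaleDr lampoly_scaleDl.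

End LambdaModule.

Section Contraction.

Variables (K : fieldType) (M V B : lmodType {poly K}) (v : V).
Variables (p1 : B -> M) (p2 : B -> cdual V) (p1L : linear p1) (p2L : linear p2).

Let Dl (q : {malg M[nat]}) := lam q + delp q.

Let DlD : add_map Dl. Proof. exact: add_map_add (@lamD K M) (@delpD K M). Qed.

Let emb (x : M) (c : K) : {malg M[nat]} := cstp (c%:P *: x).

Let embD x : add_map (emb x).
Proof. by move=> c d; rewrite /emb polyCD scalerDl cstpD. Qed.

(** The pairing of the second factor with [v], the variable of the functional
    being replaced by [lambda + d]; under this substitution the operator
    [- d1 - d2] becomes multiplication by lambda. *)
Definition contract (x y : B) : lampoly M := psum Dl (emb (p1 x)) (p2 y v).

Lemma contract_klin1 y : klin (contract^~ y : B -> lampoly M).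
Proof.
move=> c x x'; rewrite /contract.
have -> : psum Dl (emb (p1 (c%:P *: x + x'))) (p2 y v) =
   psum Dl (fun d => mapc (fun z : M => c%:P *: z) (emb (p1 x) d) +
                     emb (p1 x') d) (p2 y v).
  rewrite p1L; apply: eq_psum => // d; rewrite /emb /cstp mapcU; last first.
    exact: scaleCD.
  by rewrite -monalgUD scalerDr !scalerA mulrC.
have cD := mapcD (I := nat) (@scaleCD K M c).
have cDl w : mapc (fun z : M => c%:P *: z) (Dl w) =
    Dl (mapc (fun z : M => c%:P *: z) w).
  rewrite /Dl (cD (lam w) (delp w)) (mapc_lam w (@scaleCD K M c)).
  rewrite (mapc_delp w (@scaleCD K M c)) // => z.
  by rewrite /del !scalerA mulrC.
rewrite [X in _ = X + _](psum_nat _ _ cD cDl).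
rewrite /psum -big_split /=; apply: eq_bigr => k _.
by rewrite (add_map_iter k DlD).
Qed.

Lemma contract_klin2 x : klin (contract x : B -> lampoly M).
Proof.
move=> c y y'; rewrite /contract.
rewrite p2L cdual_addE cdual_scaleE comp_polyC.
have cD := mapcD (I := nat) (@scaleCD K M c).
rewrite (psumD DlD (embD (p1 x))); congr (_ + _).
apply: (psumCM DlD (embD (p1 x)) _ cD) => [w|d].
  rewrite /Dl (cD (lam w) (delp w)) (mapc_lam w (@scaleCD K M c)).
  rewrite (mapc_delp w (@scaleCD K M c)) // => z.
  by rewrite /del !scalerA mulrC.
by rewrite /emb /cstp mapcU ?polyCM ?scalerA //; exact: scaleCD.
Qed.

Lemma contract_bilin : bilin (contract : restr B -> restr B -> lampoly M).
Proof. exact: bilin_klin contract_klin1 contract_klin2. Qed.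

Definition contraction : tensor2 B -> lampoly M :=
  @tlift K (restr B) (restr B) (lampoly M) contract.

Lemma contractionD : add_map contraction.
Proof. exact: tlift_add contract_bilin. Qed.

Lemma contraction_pure x y : contraction (pure2 x y) = contract x y.
Proof. exact: (tlift_pure contract_bilin). Qed.

Lemma contraction_del1 t : contraction (del2_1 t) = delp (contraction t).
Proof.
move: t; apply: eq_add_tensor2 => [||x y].
- exact: add_map_comp (linear_add_map (@del2_1_linear K B)) contractionD.
- exact: add_map_comp contractionD (@delpD K M).
rewrite del2_1_pure !contraction_pure /contract; apply/esym.
rewrite (psum_nat (Psi := Dl) (g := @delp K M) _ _ (@delpD K M)).
  apply: eq_psum => // c; rewrite /= /emb /delp /cstp mapcU; last exact: delD.
  by rewrite /del (linear_scale p1L) !scalerA mulrC.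
by move=> w; rewrite /Dl (delpD (lam w)) [X in X + _]mapc_lam //; exact: delD.
Qed.

Lemma contraction_del2 t :
  contraction (del2_2 t) = - (lam (contraction t) + delp (contraction t)).
Proof.
move: t; apply: eq_add_tensor2 => [||x y].
- exact: add_map_comp (linear_add_map (@del2_2_linear K B)) contractionD.
- exact: add_map_comp contractionD (add_map_opp DlD).
rewrite del2_2_pure !contraction_pure /contract.
rewrite /del (linear_scale p2L) cdual_scaleE comp_polyX mulNr.
rewrite (add_mapN (psumD DlD (embD (p1 x)))); congr (- _).
exact: (psumXM DlD (embD _)).
Qed.

Lemma contraction_Phi t :
  contraction (- del2_2 t - del2_1 t) = lam (contraction t).
Proof.
apply: etrans (add_mapB contractionD _ _) _.
apply: etrans (congr2 (fun a b => a - b)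
  (add_mapN contractionD _) (contraction_del1 t)) _.
apply: etrans (congr1 (fun a => - a - _) (contraction_del2 t)) _.
by rewrite opprK addrK.
Qed.

End Contraction.

Section SymmetricForm.

Variables (K : fieldType) (V : lmodType {poly K}).
Variables (m : nat) (vs : 'I_m -> cdual V).

Variables (M B : lmodType {poly K}) (j1 : M -> B) (j2 : cdual V -> B).
Hypotheses (j1L : linear j1).

Definition Phi12 (t : tensor2 B) : tensor2 B := - del2_2 t - del2_1 t.

Lemma Phi12_linear : linear Phi12.
Proof. exact: linear_oppB (@del2_2_linear K B) (@del2_1_linear K B). Qed.

Let PhiD := linear_add_map Phi12_linear.

Definition sym_pair (f : cdual V) (y : M) : tensor2 B :=
  pure2 (j1 y) (j2 f) + pure2 (j2 f) (j1 y).

Let j1D := linear_add_map j1L.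

Lemma sym_pairD f : add_map (sym_pair f).
Proof.
apply: add_map_add.
- exact: add_map_comp j1D (klinD (@pure2_klin1 K B (j2 f))).
- exact: add_map_comp j1D (klinD (@pure2_klin2 K B (j2 f))).
Qed.

(** The tensor r of the family [q]: lambda is replaced by - d1 - d2. The sum and
    the symmetrization are taken for an arbitrary module [B] with embeddings of
    [M] and of the conformal dual, so as to apply both to R and to the image. *)
Definition rform (q : 'I_m -> {malg M[nat]}) : tensor2 B :=
  \sum_i psubst Phi12 (sym_pair (vs i)) (q i).

Let swap2 (t : tensor2 B) : tensor2 B := @tswap K (restr B) (restr B) t.

Let swap2D : add_map swap2.
Proof.
apply: tlift_add.
by split=> *; rewrite ?tpureDl ?tpureDr ?tpureZl ?tpureZr.
Qed.

Let swap2_pure (x y : B) : swap2 (pure2 x y) = pure2 y x.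
Proof. exact: tswap_pure. Qed.

Let d1D := linear_add_map (@del2_1_linear K B).
Let d2D := linear_add_map (@del2_2_linear K B).

Let swap2_del1 (t : tensor2 B) : swap2 (del2_1 t) = del2_2 (swap2 t).
Proof.
move: t; apply: eq_add_tensor2 => [||x y].
- exact: add_map_comp d1D swap2D.
- exact: add_map_comp swap2D d2D.
- by rewrite del2_1_pure !swap2_pure del2_2_pure.
Qed.

Let swap2_del2 (t : tensor2 B) : swap2 (del2_2 t) = del2_1 (swap2 t).
Proof.
move: t; apply: eq_add_tensor2 => [||x y].
- exact: add_map_comp d2D swap2D.
- exact: add_map_comp swap2D d1D.
- by rewrite del2_2_pure !swap2_pure del2_1_pure.
Qed.

Let swap2_Phi t : swap2 (Phi12 t) = Phi12 (swap2 t).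
Proof.
by apply: etrans (morph_oppB t swap2D swap2_del2 swap2_del1) _; exact: addrC.
Qed.

Let swap2_sym_pair f y : swap2 (sym_pair f y) = sym_pair f y.
Proof.
by rewrite /sym_pair swap2D !swap2_pure addrC.
Qed.

Lemma rform_symmetric q : symmetric_tensor (rform q).
Proof.
apply: etrans (add_map_sum swap2D _ _ _) _; apply: eq_bigr => i _.
apply: etrans (psubst_nat _ _ swap2D swap2_Phi) _.
exact: eq_psubstr (swap2_sym_pair (vs i)).
Qed.

(** The terms of positive degree in lambda lie in the image of - d1 - d2. *)
Lemma rform_const q : exists t, rform q =
  \sum_i sym_pair (vs i) (q i)@_0%N + (del2_1 t + del2_2 t).
Proof.
have /choice[t tE] i : exists t, psubst Phi12 (sym_pair (vs i)) (q i) =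
    sym_pair (vs i) (q i)@_0%N + Phi12 t.
  exact: psubst_const PhiD (@sym_pairD _).
exists (- \sum_i t i).
have -> : del2_1 (- \sum_i t i) + del2_2 (- \sum_i t i) = Phi12 (\sum_i t i).
  by rewrite addrC (add_mapN d1D) (add_mapN d2D).
rewrite (add_map_sum PhiD) -big_split.
by apply: eq_bigr => i _; exact: tE.
Qed.

Variables (p1 : B -> M) (p2 : B -> cdual V) (p1L : linear p1) (p2L : linear p2).
Hypotheses (p1j1 : forall y, p1 (j1 y) = y)
  (p2j1 : forall y, p2 (j1 y) = 0) (p2j2 : forall f, p2 (j2 f) = f).

(** Contraction with [v k] turns [- d1 - d2] into lambda, and the functionals
    [vs i] into Kronecker symbols that retain the k-th polynomial only. *)
Lemma contraction_rform (v : 'I_m -> V) q k :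
  (forall i, vs i (v k) = (i == k)%:R) ->
  contraction (v k) p1 p2 (rform q) = q k.
Proof.
move=> vsv; have tD := contractionD (v k) p1L p2L.
have lD := @lamD K M.
have contraction_pair i y : contraction (v k) p1 p2 (sym_pair (vs i) y) =
    psum (fun q : {malg M[nat]} => lam q + delp q)
      (fun c => cstp (c%:P *: y)) (i == k)%:R.
  apply: etrans (tD _ _) _.
  apply: etrans (congr2 +%R (contraction_pure _ p1L p2L _ _)
    (contraction_pure _ p1L p2L _ _)) _.
  rewrite /contract p1j1 p2j2 p2j1 vsv [X in _ + X]/psum size_poly0 big_ord0.
  exact: addr0.
have aD := add_map_add lD (@delpD K M).
have eD (y : M) : add_map (fun c : K => cstp (c%:P *: y)).
  by move=> c d; rewrite polyCD scalerDl cstpD.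
apply: etrans (add_map_sum tD _ _ _) _; rewrite (bigD1 k) //= big1 => [|i ik].
  apply: etrans (addr0 _) _.
  apply: etrans (psubst_nat _ _ tD (contraction_Phi (v k) p1L p2L)) _.
  transitivity (psubst (@lam K M) (fun x => cstp (id x)) (q k)).
    apply: eq_psubstr => y; apply: etrans (contraction_pair k y) _; rewrite eqxx.
    by rewrite (psumC aD (eD y)) scale1r.
  rewrite -mapc_psubst //; apply/malgP => l.
  by rewrite (mcoeffc _ _ (f := id)).
apply: etrans (psubst_nat _ _ tD (contraction_Phi (v k) p1L p2L)) _.
transitivity (psubst (@lam K M) (fun x : M => 0) (q i)).
  apply: eq_psubstr => y; apply: etrans (contraction_pair i y) _.
  by rewrite (negPf ik) (add_map0 (psumD aD (eD y))).
by rewrite /psubst big1 // => l _; exact: add_map0 (add_map_iter l lD).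
Qed.

End SymmetricForm.

Section PolynomialAction.

Variables (K : fieldType) (M : lmodType {poly K}) (W : lmodType K).

Lemma psubst_poly_act (Phi Psi : W -> W) (emb : M -> W) a x :
  linear Phi -> linear Psi -> klin emb ->
  (forall y, emb (del y) = Psi (emb y)) ->
  psubst Phi emb (poly_act a x) = act2 Phi Psi a (emb x).
Proof.
move=> PhiL PsiL embL embP; have PhiD := linear_add_map PhiL.
have PsiD := linear_add_map PsiL; have embD := klinD embL.
have scD c n F : linear F -> iter n F (c *: emb x) = c *: iter n F (emb x).
  by move=> FL; apply/esym/iter_swap => w; rewrite linear_scale.
have emb_poly p : emb (p *: x) = psum Psi (fun c => c *: emb x) p.
  move: p; apply: psum_unique => // [c d|p q|c|q].
  - by rewrite scalerDl.
  - by rewrite scalerDl embD.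
  - exact: klinZ.
  - by rewrite mulrC -scalerA embP.
rewrite /poly_act (add_map_sum (psubstD PhiD embD)); apply: eq_bigr => k _.
rewrite psubstU // emb_poly (add_map_sum (add_map_iter k PhiD)).
apply: eq_bigr => l _; rewrite scD //; apply/esym/iter_swap => w.
by rewrite (linear_scale PhiL).
Qed.

End PolynomialAction.

Section TensorOfOperator.

Variables (K : fieldType) (M V B : lmodType {poly K}) (m n : nat).
Variables (j1 : M -> B) (j2 : cdual V -> B) (j1L : linear j1).
Variables (vs : 'I_m -> cdual V) (e : 'I_n -> M).
Variables (a : 'I_m -> 'I_n -> {poly {poly K}}).

Lemma act2_rform :
  \sum_(i < m) \sum_(j < n)
    (act2 (@Phi12 K B) (@del2_1 K B) (a i j) (pure2 (j1 (e j)) (j2 (vs i))) +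
     act2 (@Phi12 K B) (@del2_2 K B) (a i j) (pure2 (j2 (vs i)) (j1 (e j)))) =
  rform vs j1 j2 (fun i => \sum_(j < n) poly_act (a i j) (e j)).
Proof.
have PhiL := @Phi12_linear K B; have PhiD := linear_add_map PhiL.
have j1K (f : B -> tensor2 B) : klin f -> klin (f \o j1).
  by move=> fL c x y /=; rewrite j1L fL.
have j1del y : j1 (del y) = del (j1 y) by rewrite /del (linear_scale j1L).
apply: eq_bigr => i _.
rewrite (add_map_sum (psubstD PhiD (sym_pairD j2 j1L (vs i)))).
apply: eq_bigr => j _; rewrite /sym_pair psubst_addl //; apply/esym.
apply: (congr2 +%R).
- apply: (psubst_poly_act _ _ PhiL (@del2_1_linear K B)).
    exact: j1K (@pure2_klin1 K B _).
  by move=> y; rewrite j1del; apply/esym/del2_1_pure.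
- apply: (psubst_poly_act _ _ PhiL (@del2_2_linear K B)).
    exact: j1K (@pure2_klin2 K B _).
  by move=> y; rewrite j1del; apply/esym/del2_2_pure.
Qed.

End TensorOfOperator.

(** * Descent to the image of the operator *)

Section Descent.

Variables (K : fieldType) (V M N A B : lmodType {poly K}).
Variables (jM : M -> A) (jA : cdual V -> A) (pM : A -> M) (pA : A -> cdual V).
Variables (jN : N -> B) (jB : cdual V -> B) (pN : B -> N) (pB : B -> cdual V).
Variables (iota : A -> B) (g : M -> N).
Hypotheses (pML : linear pM) (pAL : linear pA).
Hypotheses (jNL : linear jN) (pNL : linear pN) (pBL : linear pB).
Hypotheses (iL : linear iota) (gL : linear g).
Hypotheses (ijM : forall x, iota (jM x) = jN (g x))
  (ijA : forall f, iota (jA f) = jB f)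
  (pNi : forall x, pN (iota x) = g (pM x)) (pBi : forall x, pB (iota x) = pA x).
Hypotheses (pNjN : forall y, pN (jN y) = y)
  (pBjN : forall y, pB (jN y) = 0) (pBjB : forall f, pB (jB f) = f).
Hypotheses (iI : injective iota) (sepB : separated (restr B)).

Definition tincl : tensor2 A -> tensor2 B :=
  tmap (U := restr A) (V := restr A) (U' := restr B) (V' := restr B) iota iota.

Let irL : linear (iota : restr A -> restr B).
Proof. by move=> c x y; apply: iL. Qed.

Let tinclD : add_map tincl.
Proof. exact: linear_add_map (tmap_linear irL irL). Qed.

Let tincl_pure x y : tincl (pure2 x y) = pure2 (iota x) (iota y).
Proof. exact: (tmap_pure irL irL). Qed.

Let tincl_inj : injective tincl.
Proof. exact: (tmap_inj irL irL iI iI sepB). Qed.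

Let i_del x : iota (del x) = del (iota x).
Proof. by rewrite /del (linear_scale iL). Qed.

Let incl_del1 t : tincl (del2_1 t) = del2_1 (tincl t).
Proof.
move: t; apply: eq_add_tensor2 => [||x y].
- exact: add_map_comp (linear_add_map (@del2_1_linear K A)) tinclD.
- exact: add_map_comp tinclD (linear_add_map (@del2_1_linear K B)).
- by rewrite del2_1_pure !tincl_pure del2_1_pure i_del.
Qed.

Let incl_del2 t : tincl (del2_2 t) = del2_2 (tincl t).
Proof.
move: t; apply: eq_add_tensor2 => [||x y].
- exact: add_map_comp (linear_add_map (@del2_2_linear K A)) tinclD.
- exact: add_map_comp tinclD (linear_add_map (@del2_2_linear K B)).
- by rewrite del2_2_pure !tincl_pure del2_2_pure i_del.
Qed.

Let incl_Phi t : tincl (Phi12 t) = Phi12 (tincl t).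
Proof. exact: (morph_oppB t tinclD incl_del2 incl_del1). Qed.

Let gD := linear_add_map gL.

Lemma tincl_rform (m : nat) (vs : 'I_m -> cdual V) (q : 'I_m -> {malg M[nat]}) :
  tincl (rform vs jM jA q) = rform vs jN jB (fun i => mapc g (q i)).
Proof.
rewrite /rform (add_map_sum tinclD); apply: eq_bigr => i _.
have PhiD := linear_add_map (@Phi12_linear K B).
rewrite (psubst_mapc gD PhiD (sym_pairD jB jNL (vs i))).
rewrite (psubst_nat _ _ tinclD incl_Phi); apply: eq_psubstr => y /=.
by rewrite /sym_pair tinclD !tincl_pure !ijM !ijA.
Qed.

Lemma contraction_tincl v (t : tensor2 A) :
  mapc g (contraction v pM pA t) = contraction v pN pB (tincl t).
Proof.
have mD := mapcD (I := nat) gD.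
move: t; apply: eq_add_tensor2 => [||x y].
- exact: add_map_comp (contractionD v pML pAL) mD.
- exact: add_map_comp tinclD (contractionD v pNL pBL).
rewrite tincl_pure !contraction_pure //.
rewrite (psum_nat (Psi := fun q : {malg N[nat]} => lam q + delp q) _ _ mD).
  rewrite /contract pBi; apply: eq_psum => // c /=.
  by rewrite /cstp mapcU // pNi (linear_scale gL).
move=> w; rewrite (mD (lam w) (delp w)) (mapc_lam w gD).
by rewrite (mapc_delp w gD) // => z; rewrite /del (linear_scale gL).
Qed.

(** Contraction commutes with the inclusion, so the coefficients of [q] lie in the
    submodule [M] as soon as the tensor lies in the tensor square of [A]; the
    tensor that they define in [A] is [r], the inclusion being injective. *)
Lemma rform_descent (m : nat) (v : 'I_m -> V) (vs : 'I_m -> cdual V)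
    (q : 'I_m -> {malg N[nat]}) (r : tensor2 A) :
  (forall i k, vs i (v k) = (i == k)%:R) ->
  tincl r = rform vs jN jB q ->
  (forall i, mapc g (contraction (v i) pM pA r) = q i) /\
  r = rform vs jM jA (fun i => contraction (v i) pM pA r).
Proof.
move=> vsv rE.
have qE i : mapc g (contraction (v i) pM pA r) = q i.
  by rewrite contraction_tincl rE contraction_rform.
split=> //; apply: tincl_inj; rewrite rE tincl_rform; congr rform.
by apply/funext => i; rewrite qE.
Qed.

End Descent.

Section RformSolves.

Variables (K : fieldType) (R V M : lmodType {poly K}).
Variables (rho : R -> V -> {malg V[nat]}).
Variables (rhos : R -> cdual V -> {malg (cdual V)[nat]}).
Hypothesis rhosE : is_dual_representation rho rhos.
Variables (m : nat) (v : 'I_m -> V) (vs : 'I_m -> cdual V).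
Hypotheses (vB : is_basis v) (vsv : forall i k, vs i (v k) = (i == k)%:R).
Variables (A : lmodType {poly K}) (pr : A -> A -> {malg A[nat]}) (T : V -> R).
Hypothesis prB : conf_bilinear pr.
Variables (inV : {linear V -> A}) (inD : {linear cdual V -> A}).
Hypotheses (prVV : forall u w, pr (inV u) (inV w) = mapc inV (rho (T u) w))
  (prVD : forall u g, pr (inV u) (inD g) = mapc inD (rhos (T u) g))
  (prD : forall g x, pr (inD g) x = 0).
Variables (j : M -> A) (jL : linear j).

Lemma rform_solves (q : 'I_m -> {malg M[nat]}) :
  (forall i, j (q i)@_0%N = inV (v i)) ->
  solves_S_equation pr (rform vs j inD q).
Proof.
move=> q0; have [t tE] := rform_const vs inD jL q.
apply: (canonical_solves rhosE vB vsv prB prVV prVD prD (t := t)).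
by rewrite tE; congr (_ + _); apply: eq_bigr => i _; rewrite /sym_pair q0.
Qed.

End RformSolves.

(** * The semidirect product and its symmetric solution *)

Section Embeddings.

Variables (K : fieldType) (R V : lmodType {poly K}) (T : {linear V -> R}).
Local Notation A := (img T * cdual V)%type.

Definition inV (u : V) : A := (to_img T u, 0).

Fact inV_linear : linear inV.
Proof.
move=> p x y; congr (_, _); first by rewrite to_imgD to_imgZ.
by apply/esym; exact: etrans (addr0 _) (scaler0 _ _).
Qed.

HB.instance Definition _ := GRing.isLinear.Build {poly K} V A _ inV inV_linear.

End Embeddings.

Section Solution.

Variables (K : fieldType) (R V : lmodType {poly K}).
Variables (rho : R -> V -> {malg V[nat]}).
Variables (rhos : R -> cdual V -> {malg (cdual V)[nat]}).
Variables (T : {linear V -> R}) (pT : img T -> img T -> {malg (img T)[nat]}).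
Hypotheses (pTE : forall u w : V,
  pT (to_img T u) (to_img T w) = mapc (to_img T) (rho (T u) w)).
Hypotheses (rhoB : conf_bilinear rho) (rhosB : conf_bilinear rhos).
Hypothesis rhosE : is_dual_representation rho rhos.
Variables (m : nat) (v : 'I_m -> V) (vs : 'I_m -> cdual V).
Hypotheses (vB : is_basis v) (vsv : forall i k, vs i (v k) = (i == k)%:R).

Local Notation A := (img T * cdual V)%type.
Local Notation pA := (semidirect_product pT rhos).

Local Notation inD := (@inr_pair K (img T) (cdual V)).

Let pTB := image_product_bilinear pTE rhoB.

Lemma semidirect_VV u w : pA (inV T u) (inV T w) = mapc (inV T) (rho (T u) w).
Proof.
have iD := linear_add_map (@inV_linear K R V T).
apply: semidirect_ext.
  apply: etrans (semidirect_fst _ _ _ _) _; apply: etrans (pTE _ _) _.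
  exact: esym (mapc_comp _ iD (@fst_add _ _ _ T)).
apply: etrans (semidirect_snd _ _ _ _) _; apply: etrans (conf0r _ rhosB) _.
apply: esym; apply: etrans (mapc_comp _ iD (@snd_add _ _ _ T)) _.
by rewrite /mapc big1 // => k _; exact: monalgU0.
Qed.

Lemma semidirect_VD u f : pA (inV T u) (inD f) = mapc inD (rhos (T u) f).
Proof.
have iD := linear_add_map (@inr_pair_linear K (img T) (cdual V)).
apply: semidirect_ext.
  apply: etrans (semidirect_fst _ _ _ _) _; apply: etrans (conf0r _ pTB) _.
  apply: esym; apply: etrans (mapc_comp _ iD (@fst_add _ _ _ T)) _.
  by rewrite /mapc big1 // => k _; exact: monalgU0.
apply: etrans (semidirect_snd _ _ _ _) _; apply: esym.
apply: etrans (mapc_comp _ iD (@snd_add _ _ _ T)) _.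
by apply/malgP => k; rewrite mcoeffc.
Qed.

Lemma semidirect_D f x : pA (inD f) x = 0.
Proof.
have f1 := mapcD (I := nat) (@fst_add K R V T).
have f2 := mapcD (I := nat) (@snd_add K R V T).
apply: semidirect_ext.
  apply: etrans (semidirect_fst _ _ _ _) _; apply: etrans (conf0l _ pTB) _.
  exact: esym (add_map0 f1).
apply: etrans (semidirect_snd _ _ _ _) _; apply: etrans (conf0l _ rhosB) _.
exact: esym (add_map0 f2).
Qed.

Let pAB : conf_bilinear pA := semidirect_bilinear pTE rhoB rhosB.

Lemma semidirect_solves (q : 'I_m -> {malg (img T)[nat]}) :
  (forall i, (q i)@_0%N = to_img T (v i)) ->
  solves_S_equation pA (rform vs inl_pair inD q).
Proof.
move=> q0; apply: (rform_solves rhosE vB vsv pAB semidirect_VV semidirect_VD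
  semidirect_D (@inl_pair_linear K (img T) (cdual V))) => i.
by rewrite q0.
Qed.

End Solution.

Lemma semidirect_incl_inj (K : fieldType) (R V : lmodType {poly K})
  (T : {linear V -> R}) : injective (@semidirect_incl K R V T).
Proof. by move=> [x f] [y g] [/val_inj -> ->]. Qed.

Section TensorOfOOperator.

Variables (K : fieldType) (R V : lmodType {poly K}).
Variables (n : nat) (e : 'I_n -> R).
Variables (m : nat) (v : 'I_m -> V) (vs : 'I_m -> cdual V).
Variables (T : chom V R) (a : 'I_m -> 'I_n -> {poly {poly K}}).
Hypotheses (eB : is_basis e)
  (vsv : forall i k, vs i (v k) = (i == k)%:R).
Hypothesis TvE : forall i, T (v i) = \sum_(j < n) poly_act (a i j) (e j).

Local Notation T0 := (chom0 T).
Local Notation A := (img T0 * cdual V)%type.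
Local Notation r := (r_tensor e vs a).

Let q i := \sum_(j < n) poly_act (a i j) (e j).

Lemma r_tensorE : r = rform vs inl_pair inr_pair q.
Proof. exact: (act2_rform inr_pair (@inl_pair_linear K R (cdual V))). Qed.

(** The contractions of [r] are the T_lambda(v_i), so that all their coefficients
    lie in T_0(V) if [r] comes from the tensor square of T_0(V) + V^*. *)
Lemma r_tensor_descent (r' : tensor2 A) : tensor2_incl r' = r ->
  exists q' : 'I_m -> {malg (img T0)[nat]},
    (forall i, (q' i)@_0%N = to_img T0 (v i)) /\
    r' = rform vs inl_pair inr_pair q'.
Proof.
rewrite r_tensorE => r'E.
have [qE r'q] := @rform_descent K V (img T0) R A (R * cdual V)%type
  inl_pair inr_pair fst snd inl_pair inr_pair fst snd
  (@semidirect_incl K R V T0) (@img_val _ _ _ T0)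
  (fun _ _ _ => erefl) (fun _ _ _ => erefl)
  (@inl_pair_linear K _ _) (fun _ _ _ => erefl) (fun _ _ _ => erefl)
  (fun _ _ _ => erefl) (fun _ _ _ => erefl)
  (fun _ => erefl) (fun _ => erefl) (fun _ => erefl) (fun _ => erefl)
  (fun _ => erefl) (fun _ => erefl) (fun _ => erefl)
  (@semidirect_incl_inj K R V T0) (free_separated eB) m v vs q r' vsv r'E.
exists (fun i => contraction (v i) fst snd r'); split=> // i; apply: val_inj.
by rewrite /= -(mcoeffc _ _ (@img_valD K R V T0)) qE /q -TvE.
Qed.

Lemma r_tensor_symmetric : symmetric_tensor r.
Proof. by rewrite r_tensorE; exact: rform_symmetric. Qed.

End TensorOfOOperator.

Theorem theorem5p3 (F : realType) (R V : lmodType {poly (complex F)})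
    (br : R -> R -> {malg R[nat]}) (n : nat) (e : 'I_n -> R)
    (m : nat) (v : 'I_m -> V) (vs : 'I_m -> cdual V)
    (rho : R -> V -> {malg V[nat]})
    (rhos : R -> cdual V -> {malg (cdual V)[nat]})
    (T : chom V R) (a : 'I_m -> 'I_n -> {poly {poly (complex F)}})
    (pT : img (chom0 T) -> img (chom0 T) -> {malg (img (chom0 T))[nat]}) :
  is_lie_conformal br ->
  is_basis e ->
  is_basis v ->
  (forall i k, vs i (v k) = (i == k)%:R) ->
  is_representation br rho ->
  is_dual_representation rho rhos ->
  is_O_operator br rho (chom0 T) ->
  (forall i, T (v i) = \sum_(j < n) poly_act (a i j) (e j)) ->
  (forall u w : V, pT (to_img (chom0 T) u) (to_img (chom0 T) w) =
     mapc (to_img (chom0 T)) (rho (chom0 T u) w)) ->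
  let pA := semidirect_product pT rhos in
  let r := r_tensor e vs a in
  [/\ is_left_symmetric_conformal pA,
      symmetric_tensor r &
      forall r' : tensor2 (img (chom0 T) * cdual V)%type,
        tensor2_incl r' = r ->
        symmetric_tensor r' /\ solves_S_equation pA r'].
Proof.
move=> _ eB vB vsv rhoR rhosE TO TvE pTE pA r.
have rhosR := dual_representation rhosE rhoR.
have rhoB := rep_bilinear rhoR; have rhosB := rep_bilinear rhosR.
split.
- exact: semidirect_left_symmetric pTE TO rhoR rhosR.
- exact: r_tensor_symmetric.
- move=> r' /(r_tensor_descent eB vsv TvE)[q' [q'0 ->]].
  split; first exact: rform_symmetric.
  exact: (semidirect_solves pTE rhoB rhosB rhosE vB vsv q'0).
Qed.
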